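(* Let $d\in\mathbb N$, $r>0$, $1\le q<p<\infty$ and $\beta:=1/q-1/p$. For any recovering operator $\Psi(\cdot,X_m)$ with respect to an $(n,n-1)$-net $X_m$ we have $$ \Psi(\mathbf H^r_q,X_m)_p \gg 2^{-n(r-\beta)}n^{(d-1)/p}. $$
   Context: $\mathbb T^d=[0,2\pi)^d$ (functions are $2\pi$-periodic in each variable) carries the normalized Lebesgue measure $(2\pi)^{-d}d\mathbf x$; $\|\cdot\|_p$ is the norm of $L_p(\mathbb T^d)$ and $\hat f(\mathbf k)=(2\pi)^{-d}\int_{\mathbb T^d}f(\mathbf x)e^{-i(\mathbf k,\mathbf x)}d\mathbf x$. A recovering operator is given by points $X_m=\{\xi^j\}_{j=1}^m\subset\mathbb T^d$ and functions $\psi_1,\dots,\psi_m\in L_p(\mathbb T^d)$: $\Psi(f,X_m):=\sum_{j=1}^mf(\xi^j)\psi_j(\mathbf x)$. For a class $\mathbf W$, $\Psi(\mathbf W,X_m)_p:=\sup_{f\in\mathbf W}\|f-\Psi(f,X_m)\|_p$, the supremum being over continuous $f\in\mathbf W$ (so that point values make sense). For $\mathbf s\in\mathbb N_0^d$ ($\mathbb N_0=\{0,1,2,\dots\}$, $\|\mathbf s\|_1=s_1+\dots+s_d$) put $w(\mathbf s,\mathbf x):=\prod_{j=1}^d\sin(2^{s_j}x_j)$ and $W(\mathbf s):=\{\mathbf x: w(\mathbf s,\mathbf x)=0\}$. A set $X_m=\{\xi^i\}_{i=1}^m$ is an $(n,l)$-net if $|X_m\setminus W(\mathbf s)|\le 2^l$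 for all $\mathbf s$ with $\|\mathbf s\|_1=n$. For $\mathbf s\in\mathbb N_0^d$ let $\rho(\mathbf s):=\{\mathbf k\in\mathbb Z^d:[2^{s_j-1}]\le|k_j|<2^{s_j},\ j=1,\dots,d\}$ ($[\cdot]$ is the integer part), $\delta_{\mathbf s}(f):=\sum_{\mathbf k\in\rho(\mathbf s)}\hat f(\mathbf k)e^{i(\mathbf k,\mathbf x)}$, $\|f\|_{\mathbf H^r_q}:=\sup_{\mathbf s}\|\delta_{\mathbf s}(f)\|_q2^{r\|\mathbf s\|_1}$, and $\mathbf H^r_q$ also denotes the unit ball $\{f:\|f\|_{\mathbf H^r_q}\le1\}$. $\gg$ means that the left side is at least $c$ times the right side, with $c>0$ independent of $n\in\mathbb N$, $m$, the net $X_m$ and the functions $\psi_j$ (it may depend on $r,p,q,d$). *)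

(* Defs.v *)
From HB Require Import structures.
From mathcomp Require Import all_boot all_order all_algebra.
From mathcomp Require Import zify.
From mathcomp Require Import complex.
From mathcomp Require Import all_classical all_reals all_analysis.

Set Implicit Arguments.
Unset Strict Implicit.
Unset Printing Implicit Defensive.

Import Order.TTheory GRing.Theory Num.Theory.
Import numFieldNormedType.Exports.

Local Open Scope classical_set_scope.
Local Open Scope ring_scope.
Local Open Scope complex_scope.

(* A function on the torus is a function 'rV[R]_d -> R[i] that is 2 pi-periodic
   in each variable. The library equips rows with a topology and tuples with
   the product sigma-algebra, so measurability, norms and integrals go through
   [row_of_tuple]. *)

Section Measure.
Context {R : realType}.

Lemma twopi_gt0 : (0 : R) < 2 * pi.
Proof. by rewrite mulr_gt0 ?pi_gt0. Qed.

Definition consT n (z : measurableTypeR R * n.-tuple (measurableTypeR R)) :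
    n.+1.-tuple (measurableTypeR R) :=
  [the n.+1.-tuple (measurableTypeR R) of z.1 :: z.2].

Lemma measurable_consT n : measurable_fun [set: _] (@consT n).
Proof. by apply: measurable_cons. Qed.

HB.instance Definition _ n :=
  isMeasurableFun.Build _ _ _ _ (@consT n) (@measurable_consT n).

(* Normalized Lebesgue measure on the torus: the d-fold product of
   (2 pi)^-1 dx on [0, 2 pi]; the endpoint 2 pi is negligible. *)
Fixpoint torus_prob (d : nat) : probability (d.-tuple (measurableTypeR R)) R :=
  match d with
  | 0 => \d_([tuple] : 0.-tuple (measurableTypeR R))
  | n.+1 => distribution (uniform_prob twopi_gt0 \x torus_prob n)%E (@consT n)
  end.

Definition row_of_tuple d (t : d.-tuple (measurableTypeR R)) : 'rV[R]_d :=
  \row_j tnth t j.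

End Measure.

Section Torus.
Context {R : realType} {d : nat}.
Implicit Types (f g : 'rV[R]_d -> R[i]) (p q r : R) (x : 'rV[R]_d)
  (k : 'rV[int]_d) (s : 'I_d -> nat).

Definition torus : set 'rV[R]_d := [set x | forall j, 0 <= x 0 j < 2 * pi].

Definition periodic2pi f :=
  forall j : 'I_d, periodic f ((2 * pi) *: delta_mx 0 j).

Definition measurableC f :=
  measurable_fun setT (fun t : d.-tuple (measurableTypeR R) =>
    complex.Re (f (row_of_tuple t))) /\
  measurable_fun setT (fun t : d.-tuple (measurableTypeR R) =>
    complex.Im (f (row_of_tuple t))).

Definition norm_p p f : \bar R :=
  Lnorm (torus_prob d) p%:E (fun t => (Normc.normc (f (row_of_tuple t)))%:E).

Definition Lp p : set ('rV[R]_d -> R[i]) :=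
  [set f | [/\ periodic2pi f, measurableC f & (norm_p p f < +oo)%E]].

Definition integralC f : R[i] :=
  (\int[torus_prob d]_t complex.Re (f (row_of_tuple t)))%R +i*
  (\int[torus_prob d]_t complex.Im (f (row_of_tuple t)))%R.

Definition character k x : R[i] :=
  let u := \sum_j (k 0 j)%:~R * x 0 j in cos u +i* sin u.

Definition fourier f k : R[i] := integralC (fun x => f x * character (- k) x).

(* [2 ^ s %/ 2] is the integer part of 2 ^ (s - 1), also for s = 0. *)
Definition rho s : set 'rV[int]_d :=
  [set k : 'rV[int]_d | forall j, (2 ^ s j %/ 2 <= `|k 0%R j| < 2 ^ s j)%N].

Lemma finite_rho s : finite_set (rho s).
Proof.
pose N := \max_(j < d) 2 ^ s j.
pose F (M : 'rV['I_(N + N).+1]_d) : 'rV[int]_d :=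
  \row_j ((M 0 j : nat)%:Z - N%:Z).
apply: (@sub_finite_set _ _ (range F)); last exact: finite_image.
move=> k /= rk.
have kN j : (`|k 0%R j| < N)%N.
  have /andP[_ /leq_trans] := rk j; apply.
  exact: (leq_bigmax (F := fun j => 2 ^ s j)%N).
exists (\row_j inord (absz (k 0 j + N%:Z))) => //.
apply/rowP => j; rewrite !mxE inordK; last by have := kN j; lia.
by have := kN j; lia.
Qed.

(* The sum over [rho s] is a finite one, by [finite_rho]. *)
Definition delta s f x : R[i] :=
  \sum_(k \in rho s) fourier f k * character k x.

Definition norm1 s : nat := \sum_j s j.

Definition normH r q f : \bar R :=
  ereal_sup [set (norm_p q (delta s f) * (2 `^ (r * (norm1 s)%:R))%:E)%E
            | s in setT].

(* Membership in L_1 is what makes the Fourier coefficients meaningful. *)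
Definition Hclass r q : set ('rV[R]_d -> R[i]) :=
  [set f | Lp 1 f /\ (normH r q f <= 1)%E].

Definition recover m (xi : 'I_m -> 'rV[R]_d) (psi : 'I_m -> 'rV[R]_d -> R[i])
    f x : R[i] :=
  \sum_j f (xi j) * psi j x.

Definition recover_err m (xi : 'I_m -> 'rV[R]_d)
    (psi : 'I_m -> 'rV[R]_d -> R[i]) (W : set ('rV[R]_d -> R[i])) p : \bar R :=
  ereal_sup [set norm_p p (fun x => f x - recover xi psi f x)
            | f in [set f | W f /\ continuous (f : 'rV[R]_d -> R[i]^o)]].

Definition w s x : R := \prod_j sin (2 ^+ s j * x 0 j).

Definition zeros_w s : set 'rV[R]_d := [set x | w s x = 0].

(* The points are counted as elements of the set {xi j}, so repetitions in the
   family [xi] do not count. *)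
Definition is_net (n l m : nat) (xi : 'I_m -> 'rV[R]_d) :=
  forall s, norm1 s = n -> (range xi `\` zeros_w s #<= `I_(2 ^ l))%card.

End Torus.

(* Main.v *)
Require Import Defs.
From mathcomp Require Import all_boot all_order all_algebra.
From mathcomp Require Import finmap complex zify ring lra.
From mathcomp Require Import all_classical all_reals all_analysis.
From mathcomp Require Import measurable_realfun.

(** The recovering operator sees nothing of a function that vanishes on the net
    [xi], so [recover_err] is at least [norm_p p f] for every continuous [f] in
    the unit ball of the class with [f (xi j) = 0] for all [j].  Such an [f]
    with a large [L_p]-norm is built as a sum of peaks, one for each level [s]
    in a family of about [n^(d-1)] multi-indices with [norm1 s = n].  Write
    [P_j = 2^(s_j)] and [S = 2^n], the product of the [P_j].

    The peak of level [s].  By the net condition at most [2^(n-1)] points of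
    the net are not zeros of [w s], and the trigonometric polynomials with
    frequencies in the box [0 <= k_j < P_j] form a space of dimension [2^n];
    so some nonzero one vanishes at those points.  Multiplying it by the product
    of the [exp(2 i P_j x_j) - 1] gives a [T <> 0] that vanishes on the whole
    net ([vanishing_poly]).  Take [y] where [|T|] is at least half of its
    supremum, multiply [T / T(y)] by the square of the Dirichlet kernel [D] of
    the box, centred at [y], and by a character; this yields [g_s] with
    [|g_s| <= 2 |D(y - x)|^2], [g_s(y) = S^2], frequencies inside one shell
    [rho], and zeros on the net ([peak_poly]).  The shells are distinct for
    distinct levels, so each [delta] of [f = lam * (sum of the g_s)] is
    [lam * g_s] or [0].  As [|D|^2 <= S^2] has mean at most [S], a choice of
    [lam] of the order of [S^(-(2 - 1/q) - r)] puts [f] in the unit ball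
    ([normH_sum_blocks]).

    Duality.  A product of two Dirichlet kernels divided by [S] gives a kernel
    [h_s] that reproduces the value at [y] of polynomials with the frequencies
    of [g_s] and is orthogonal to the other peaks ([repkernel_reproduce],
    [repkernel_orthogonal]).  With [N] levels and [1/p + 1/u = 1], Hoelder's
    inequality gives
      [N * lam * S^2 <= norm_p p f * (mean (sum |h_s|)^u)^(1/u)].

    It remains to show that the mean of [(sum |h_s|)^u] is at most a constant
    times [S^(u-1) * N] ([mean_sum_powR]), wherever the centres [y] lie.
    Parseval's identity and a count of the solutions of [a + b = a' + b'] in
    boxes show that [|h_s|] has a bounded mean and that [|h_s| |h_s'|] has mean
    at most a constant times [prod_j min(P_j, P'_j)], which is at most
    [S * 2^(-D)] with [D] half of an [l_1]-distance of the levels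
    ([mean_repkernel_pair], [prod_min_level]).  Comparing every term with the
    largest one shows that, pointwise, [(sum h_s)^u] is at most a constant
    times the sum over pairs of [2^(eps D) h_s' h_s^(u-1)] ([sum_le_pairs]).
    The exponent [u - 1], which may be smaller or larger than 1, is reduced to
    a linear one by [powR_le_linear], so that pairs contribute
    [S^(u-1) 2^(-eps' D)], and these sum to a constant times [S^(u-1) * N]
    ([sum_level_dist]).  Collecting the exponents of 2 and the powers of [N]
    gives the bound. *)

Set Implicit Arguments.
Unset Strict Implicit.
Unset Printing Implicit Defensive.
Import Order.TTheory GRing.Theory Num.Theory.
Import numFieldNormedType.Exports.
Local Open Scope classical_set_scope.
Local Open Scope ring_scope.
Local Open Scope complex_scope.

(** * Means of bounded measurable functions on the torus *)

Lemma bounded_integrable (d0 : measure_display) (T : measurableType d0)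
    (R : realType) (P : probability T R) (f : T -> R) M :
  measurable_fun setT f -> (forall x, `|f x| <= M) ->
  P.-integrable setT (EFin \o f).
Proof.
move=> mf fM; apply: measurable_bounded_integrable => //.
  by apply: le_lt_trans (ltry 1); exact: probability_le1.
by exists M; split; [exact: num_real | move=> K MK t _; apply: (le_trans _ (ltW MK))].
Qed.

Section Mean.
Context {R : realType} {d : nat}.
Implicit Types (f g : 'rV[R]_d -> R).

(** Mean value over the torus. *)
Definition mean f : R := \int[torus_prob d]_t f (row_of_tuple t).

(** [f] is bounded, and measurable as a function of the tuple of coordinates;
    such functions are integrable and stable under the operations used below. *)
Definition bm f : Prop :=
  measurable_fun setT (fun t : d.-tuple (measurableTypeR R) =>
    f (row_of_tuple t)) /\ exists M, forall x, `|f x| <= M.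

Lemma eq_bm f g : f =1 g -> bm g -> bm f.
Proof. by move=> /funext ->. Qed.

Lemma bm_cst c : bm (fun=> c).
Proof. by split; [exact: measurable_cst | exists `|c|]. Qed.

Lemma bmD f g : bm f -> bm g -> bm (fun x => f x + g x).
Proof.
move=> [mf [M Mf]] [mg [K Kg]]; split; first exact: measurable_funD.
by exists (M + K) => x; rewrite (le_trans (ler_normD _ _))// lerD.
Qed.

Lemma bmM f g : bm f -> bm g -> bm (fun x => f x * g x).
Proof.
move=> [mf [M Mf]] [mg [K Kg]]; split; first exact: measurable_funM.
by exists (M * K) => x; rewrite normrM ler_pM.
Qed.

Lemma bmZ c f : bm f -> bm (fun x => c * f x).
Proof. by move=> bf; apply: bmM => //; exact: bm_cst. Qed.

Lemma bmN f : bm f -> bm (fun x => - f x).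
Proof.
by move=> /(bmZ (-1)); congr bm; apply/funext => x; rewrite mulN1r.
Qed.

Lemma bmB f g : bm f -> bm g -> bm (fun x => f x - g x).
Proof. by move=> bf bg; apply: bmD => //; exact: bmN. Qed.

Lemma bm_sum (I : Type) (s : seq I) (P : pred I) (F : I -> 'rV[R]_d -> R) :
  (forall i, P i -> bm (F i)) -> bm (fun x => \sum_(i <- s | P i) F i x).
Proof.
move=> bF; elim: s => [|i s IH].
  by apply: eq_bm (bm_cst 0) => x; rewrite big_nil.
have [Pi|nPi] := boolP (P i); last first.
  by apply: eq_bm IH => x; rewrite big_cons (negbTE nPi).
by apply: eq_bm (bmD (bF i Pi) IH) => x; rewrite big_cons Pi.
Qed.

Lemma bm_powR f a : 0 <= a -> (forall x, 0 <= f x) -> bm f ->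
  bm (fun x => f x `^ a).
Proof.
move=> a0 f0 [mf [M Mf]]; split; first exact: measurableT_comp (measurable_powR _) mf.
exists (M `^ a) => x; rewrite ger0_norm ?powR_ge0//.
have fM : f x <= M by rewrite -(ger0_norm (f0 x)).
by rewrite ge0_ler_powR ?nnegrE//; exact: le_trans fM.
Qed.

Lemma bm_integrable f : bm f ->
  (torus_prob d).-integrable setT (EFin \o (fun t => f (row_of_tuple t))).
Proof.
move=> [mf [M Mf]].
exact: (bounded_integrable (torus_prob d) mf (fun t => Mf (row_of_tuple t))).
Qed.

Lemma eq_mean f g : f =1 g -> mean f = mean g.
Proof. by move=> fg; congr mean; apply/funext. Qed.

Lemma meanD f g : bm f -> bm g -> mean (fun x => f x + g x) = mean f + mean g.
Proof.
by move=> bf bg; rewrite /mean RintegralD//; exact: bm_integrable.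
Qed.

Lemma meanZ c f : bm f -> mean (fun x => c * f x) = c * mean f.
Proof. by move=> bf; rewrite /mean RintegralZl//; exact: bm_integrable. Qed.

Lemma mean_cst c : mean (fun=> c) = c.
Proof.
rewrite -[RHS]mulr1 /mean Rintegral_cst//; congr (_ * _).
exact: (congr1 fine (@probability_setT _ _ _ (torus_prob d))).
Qed.

Lemma meanB f g : bm f -> bm g -> mean (fun x => f x - g x) = mean f - mean g.
Proof.
by move=> bf bg; rewrite /mean RintegralB//; exact: bm_integrable.
Qed.

Lemma mean_sum (I : Type) (s : seq I) (P : pred I) (F : I -> 'rV[R]_d -> R) :
  (forall i, P i -> bm (F i)) ->
  mean (fun x => \sum_(i <- s | P i) F i x) = \sum_(i <- s | P i) mean (F i).
Proof.
move=> bF; elim: s => [|i s IH].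
  rewrite big_nil; apply: etrans (mean_cst 0); apply: eq_mean => x.
  by rewrite big_nil.
rewrite big_cons -IH; case: ifPn => Pi; last first.
  by apply: eq_mean => x; rewrite big_cons (negbTE Pi).
rewrite -meanD; [|exact: bF|exact: bm_sum].
by apply: eq_mean => x; rewrite big_cons Pi.
Qed.

Lemma le_mean f g : bm f -> bm g -> (forall x, f x <= g x) -> mean f <= mean g.
Proof. by move=> bf bg fg; apply: le_Rintegral => //; exact: bm_integrable. Qed.

Lemma mean_ge0 f : (forall x, 0 <= f x) -> 0 <= mean f.
Proof. by move=> f0; exact: Rintegral_ge0. Qed.

End Mean.

(** * Orthogonality of the exponentials *)

Section Uniform.
Context {R : realType}.
Local Notation U := (uniform_prob (@twopi_gt0 R)).


(** The bound by 1 makes [f + 1] nonnegative, as required by [integral_uniform]. *)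
Lemma Rint_uniform_FTC (f F : R -> R) :
  continuous f -> (forall x, `|f x| <= 1) ->
  (forall x : R, is_derive x 1 F (f x)) ->
  \int[U]_x f x = (2 * pi)^-1 * (F (2 * pi) - F 0).
Proof.
move=> cf f1 dF.
have mf : measurable_fun setT f by exact: continuous_measurable_fun.
have cF : continuous F.
  move=> x; apply: differentiable_continuous; apply/derivable1_diffP.
  by have [] := dF x.
pose g x := f x + 1; pose G x := F x + x.
have cg : continuous g by move=> x; apply: cvgD; [exact: cf|exact: cvg_cst].
have mg : measurable_fun setT g by exact: continuous_measurable_fun.
have dG (x : R) : is_derive x 1 G (g x) by exact: is_deriveD.
have g0 x : 0 <= g x.
  by rewrite /g -lerBlDr sub0r; have := f1 x; rewrite ler_norml => /andP[].
have intg : \int[U]_x g x = \int[U]_x f x + 1.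
  rewrite RintegralD//.
  - rewrite Rintegral_cst// mul1r; congr (_ + _).
    exact: (congr1 fine (@probability_setT _ _ _ U)).
  - exact: (@bounded_integrable _ _ _ U f 1).
  - by apply: (@bounded_integrable _ _ _ U (fun=> 1) 1) => // x; rewrite normr1.
have -> : \int[U]_x f x = \int[U]_x g x - 1 by rewrite intg addrK.
rewrite /Rintegral integral_uniform//; last exact/measurable_EFinP.
have cG : continuous G.
  move=> x; apply: differentiable_continuous; apply/derivable1_diffP.
  by have [] := dG x.
rewrite (@continuous_FTC2 _ g G)//; first last.
- by move=> x _; rewrite derive1E; have [_ ->] := dG x.
- split.
  + by move=> x _; have [] := dG x.
  + exact/cvg_at_right_filter/cG.
  + exact/cvg_at_left_filter/cG.
- exact: continuous_subspaceT.
- exact: twopi_gt0.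
rewrite subr0 -EFinB -EFinM/= /G addr0.
have p0 : (2 * pi : R) != 0 by rewrite gt_eqF// twopi_gt0.
rewrite addrAC mulrDr mulVf// addrK; congr (_ * _).
Qed.



End Uniform.

Section Expi.
Context {R : realType}.

(** The complex exponential [exp(i u)]. *)
Definition expi (u : R) : R[i] := cos u +i* sin u.

Lemma expi0 : expi 0 = 1.
Proof. by rewrite /expi cos0 sin0. Qed.

Lemma expiD u v : expi (u + v) = expi u * expi v.
Proof.
by rewrite /expi cosD sinD; apply/eqP; rewrite eq_complex/= eqxx addrC eqxx.
Qed.

Lemma expiN u : expi (- u) = (expi u)^*%C.
Proof. by rewrite /expi cosN sinN. Qed.

Lemma normc_expi u : Normc.normc (expi u) = 1.
Proof. by rewrite /Normc.normc /expi cos2Dsin2 sqrtr1. Qed.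

Lemma expi_2pi (k : int) : expi (k%:~R * (2 * pi)) = 1.
Proof.
have e1 : expi (2 * pi) = 1.
  by rewrite /expi mulr_natl cos2pi sin2pi.
have en n : expi (n%:R * (2 * pi)) = 1.
  elim: n => [|n IH]; first by rewrite mul0r expi0.
  by rewrite -addn1 natrD mulrDl mul1r expiD IH e1 mulr1.
case: k => n; first by rewrite -pmulrn en.
rewrite NegzE rmorphN/= mulNr expiN -pmulrn en; apply/eqP.
by rewrite eq_complex/= oppr0 !eqxx.
Qed.

End Expi.

Section Orthogonality.
Context {R : realType}.
Local Notation U := (uniform_prob (@twopi_gt0 R)).

Lemma Rint_uniform_cos_sin (k : int) :
  \int[U]_x cos (k%:~R * x) = (k == 0)%:R /\ \int[U]_x sin (k%:~R * x) = 0.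
Proof.
have P1 : forall c : R, \int[U]_x c = c.
  move=> c; rewrite -[RHS]mulr1 Rintegral_cst//; congr (_ * _).
  exact: (congr1 fine (@probability_setT _ _ _ U)).
have [->|k0] := eqVneq k 0.
  split.
    by rewrite -[RHS]P1; apply: eq_Rintegral => x _; rewrite mul0r cos0.
  by rewrite -[RHS]P1; apply: eq_Rintegral => x _; rewrite mul0r sin0.
have c0 : (k%:~R : R) != 0 by rewrite intr_eq0.
have [ec es] : cos (k%:~R * (2 * pi)) = 1 :> R /\ sin (k%:~R * (2 * pi)) = 0 :> R.
  by have := @expi_2pi R k; rewrite /expi => -[-> ->].
have ck : continuous (fun x : R => k%:~R * x).
  by move=> x; apply: cvgM; [exact: cvg_cst|exact: cvg_id].
have dk (x : R) : is_derive x 1 (fun x : R => k%:~R * x) k%:~R.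
  by have := is_deriveZ k%:~R (is_derive_id x 1); rewrite /GRing.scale/= mulr1.
have cosE : continuous (fun x : R => cos (k%:~R * x)).
  move=> x; apply: (@continuous_comp _ _ _ (fun x : R => k%:~R * x) cos).
    exact: ck.
  exact: continuous_cos.
have sinE : continuous (fun x : R => sin (k%:~R * x)).
  move=> x; apply: (@continuous_comp _ _ _ (fun x : R => k%:~R * x) sin).
    exact: ck.
  exact: continuous_sin.
split.
- pose F x : R := k%:~R^-1 * sin (k%:~R * x).
  have dF (x : R) : is_derive x 1 F (cos (k%:~R * x)).
    have := is_deriveZ k%:~R^-1
      (is_derive1_comp (is_derive_sin (k%:~R * x)) (dk x)).
    by rewrite /GRing.scale/= [_^-1 * _]mulrC mulfK.
  rewrite (Rint_uniform_FTC cosE _ dF).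
    by rewrite /F es !mulr0 sin0 mulr0 subrr mulr0.
  by move=> x; rewrite ler_norml cos_geN1 cos_le1.
- pose F x : R := - k%:~R^-1 * cos (k%:~R * x).
  have dF (x : R) : is_derive x 1 F (sin (k%:~R * x)).
    have := is_deriveZ (- k%:~R^-1)
      (is_derive1_comp (is_derive_cos (k%:~R * x)) (dk x)).
    by rewrite /GRing.scale/= !mulNr mulrN opprK [_^-1 * _]mulrC mulfK.
  rewrite (Rint_uniform_FTC sinE _ dF).
    by rewrite /F ec mulr0 cos0 subrr mulr0.
  by move=> x; rewrite ler_norml sin_geN1 sin_le1.
Qed.

(** Fubini's theorem for the first coordinate. *)
Lemma Rint_torusS n (f : n.+1.-tuple (measurableTypeR R) -> R) M :
  measurable_fun setT f -> (forall t, `|f t| <= M) ->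
  \int[torus_prob n.+1]_t f t =
  \int[U]_x \int[torus_prob n]_t f (consT (x, t)).
Proof.
move=> mf fM.
have mfc : measurable_fun setT (f \o @consT R n).
  exact: measurableT_comp mf (@measurable_consT R n).
have intf : (U \x torus_prob n)%E.-integrable setT (EFin \o (f \o @consT R n)).
  by apply: (@bounded_integrable _ _ _ (U \x torus_prob n)%E _ M) => // x; exact: fM.
rewrite /Rintegral /=.
rewrite integral_distribution//; last exact/measurable_EFinP.
rewrite -integral12_prod_meas1//.
congr fine; apply: eq_integral => x _.
rewrite /fubini_F/= fineK//.
apply: integrable_fin_num => //.
apply: (@bounded_integrable _ _ _ (torus_prob n) (fun t => f (consT (x, t))) M) => //.
apply: measurableT_comp mf _; apply: measurable_cons.
- exact: (measurable_cst x).
- exact: measurable_id.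
Qed.

Lemma Rint_torus_cos_sin n (k : 'I_n -> int) :
  \int[torus_prob n]_t cos (\sum_j (k j)%:~R * tnth t j) =
    [forall j, k j == 0]%:R :> R /\
  \int[torus_prob n]_t sin (\sum_j (k j)%:~R * tnth t j) = 0 :> R.
Proof.
have msum m (l : 'I_m -> int) :
    measurable_fun setT (fun t : m.-tuple (measurableTypeR R) =>
    \sum_j (l j)%:~R * tnth t j : R).
  apply: measurable_sum => j; apply: measurable_funM => //.
  exact: measurable_tnth.
have mc m (l : 'I_m -> int) :
    measurable_fun setT (fun t : m.-tuple (measurableTypeR R) =>
    cos (\sum_j (l j)%:~R * tnth t j : R)).
  exact: measurableT_comp (continuous_measurable_fun (@continuous_cos R)) (msum _ _).
have ms m (l : 'I_m -> int) :
    measurable_fun setT (fun t : m.-tuple (measurableTypeR R) =>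
    sin (\sum_j (l j)%:~R * tnth t j : R)).
  exact: measurableT_comp (continuous_measurable_fun (@continuous_sin R)) (msum _ _).
have bc (u : R) : `|cos u| <= 1 by rewrite ler_norml cos_geN1 cos_le1.
have bs (u : R) : `|sin u| <= 1 by rewrite ler_norml sin_geN1 sin_le1.
elim: n k => [|n IH] k.
  rewrite /Rintegral /= !integral_dirac//; last 2 first.
  - apply/measurable_EFinP; exact: (ms 0 k).
  - apply/measurable_EFinP; exact: (mc 0 k).
  rewrite /= !indicT !mul1r !big_ord0 cos0 sin0; split => //.
  by case: forallP => //; case; case.
have [kc ks] := Rint_uniform_cos_sin (k ord0).
have [IHc IHs] := IH (fun j => k (lift ord0 j)).
have sumE x (t : n.-tuple (measurableTypeR R)) :
    \sum_j (k j)%:~R * tnth (consT (x, t)) j =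
    (k ord0)%:~R * x + \sum_j (k (lift ord0 j))%:~R * tnth t j.
  by rewrite big_ord_recl; congr (_ + _); apply: eq_bigr => j _; rewrite tnthS.
have ic : (torus_prob n).-integrable setT (EFin \o
    (fun t : n.-tuple (measurableTypeR R) =>
      cos (\sum_j (k (lift ord0 j))%:~R * tnth t j))).
  exact: (bounded_integrable _ (mc _ _) (fun=> bc _)).
have is_ : (torus_prob n).-integrable setT (EFin \o
    (fun t : n.-tuple (measurableTypeR R) =>
      sin (\sum_j (k (lift ord0 j))%:~R * tnth t j))).
  exact: (bounded_integrable _ (ms _ _) (fun=> bs _)).
have intZ (a : R) (g : n.-tuple (measurableTypeR R) -> R) :
    (torus_prob n).-integrable setT (EFin \o g) ->
    (torus_prob n).-integrable setT (EFin \o (fun t => a * g t)).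
  move=> ig; have := integrableZl measurableT a ig.
  by apply: eq_integrable => // x _; rewrite /= EFinM.
have icu (c : R) (g : R -> R) : continuous g -> (forall x, `|g x| <= 1) ->
    U.-integrable setT (EFin \o (fun x => g (c * x))).
  move=> cg bg; apply: (@bounded_integrable _ _ _ U _ 1) => //.
  by apply: measurableT_comp (continuous_measurable_fun cg) _; apply: measurable_funM.
have dE : [forall j, k j == 0]%:R =
    (k ord0 == 0)%:R * [forall j, k (lift ord0 j) == 0]%:R :> R.
  rewrite -natrM mulnb; congr (nat_of_bool _)%:R.
  apply/forallP/andP => [k0|[k0 /forallP k1] j].
    by split => //; apply/forallP => j; exact: k0.
  by case: (unliftP ord0 j) => [i|] ->.
split.
- rewrite (@Rint_torusS _ _ 1)// dE -{1}kc -RintegralZr//; last first.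
    exact: icu (@continuous_cos R) _.
  apply: eq_Rintegral => x _.
  under eq_Rintegral do rewrite sumE cosD.
  rewrite RintegralB//; [|exact: intZ|exact: intZ].
  by rewrite !RintegralZl// IHc IHs mulr0 subr0.
- rewrite (@Rint_torusS _ _ 1)//.
  transitivity ((\int[U]_x sin ((k ord0)%:~R * x)) *
    [forall j, k (lift ord0 j) == 0]%:R); last by rewrite ks mul0r.
  rewrite -RintegralZr//; last exact: icu (@continuous_sin R) _.
  apply: eq_Rintegral => x _.
  under eq_Rintegral do rewrite sumE sinD.
  rewrite RintegralD//; [|exact: intZ|exact: intZ].
  by rewrite !RintegralZl// IHc IHs mulr0 addr0.
Qed.

End Orthogonality.

(** * Means of complex functions and characters *)

Local Notation normc := Normc.normc.

Section ComplexAux.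
Context {R : realType}.
Implicit Types x y : R[i].

Lemma Re_add x y : complex.Re (x + y) = complex.Re x + complex.Re y.
Proof. by case: x y => [a b] [c e]. Qed.

Lemma Im_add x y : complex.Im (x + y) = complex.Im x + complex.Im y.
Proof. by case: x y => [a b] [c e]. Qed.

Lemma Re_mul x y : complex.Re (x * y) =
  complex.Re x * complex.Re y - complex.Im x * complex.Im y.
Proof. by case: x y => [a b] [c e]. Qed.

Lemma Im_mul x y : complex.Im (x * y) =
  complex.Re x * complex.Im y + complex.Im x * complex.Re y.
Proof. by case: x y => [a b] [c e] /=; rewrite addrC. Qed.

Lemma complex_ext x y :
  complex.Re x = complex.Re y -> complex.Im x = complex.Im y -> x = y.
Proof. by case: x y => [a b] [c e] /= -> ->. Qed.

Lemma normc_ge0 x : 0 <= normc x.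
Proof. by case: x => a b; rewrite sqrtr_ge0. Qed.

Lemma normc_sq x : normc x ^+ 2 = complex.Re x ^+ 2 + complex.Im x ^+ 2.
Proof. by case: x => a b; rewrite /= sqr_sqrtr// addr_ge0// sqr_ge0. Qed.

Lemma normc_sqE x : normc x ^+ 2 = complex.Re (x * x^*%C).
Proof. by rewrite normc_sq Re_mul; case: x => a b /=; rewrite mulrN opprK. Qed.

Lemma normc_real (a : R) : normc (a%:C) = `|a|.
Proof. by rewrite /= expr0n addr0 sqrtr_sqr. Qed.

Lemma Re_le_normc x : complex.Re x <= normc x.
Proof.
case: x => a b /=; rewrite (le_trans (ler_norm a))//.
by rewrite -sqrtr_sqr ler_wsqrtr// lerDl sqr_ge0.
Qed.

Lemma conjc_mul x y : (x * y)^*%C = x^*%C * y^*%C.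
Proof.
case: x y => [a b] [c e]; apply: complex_ext => /=; first by rewrite mulrNN.
by rewrite opprD !mulrN !mulNr.
Qed.

Lemma conjc_sum (I : Type) (s : seq I) (P : pred I) (F : I -> R[i]) :
  (\sum_(i <- s | P i) F i)^*%C = \sum_(i <- s | P i) (F i)^*%C.
Proof.
apply: (big_morph (@conjc R)); last by rewrite /= oppr0.
by move=> [a b] [c e]; apply: complex_ext; rewrite //= opprD.
Qed.

Lemma normc_conj x : normc (x^*%C) = normc x.
Proof. by case: x => a b; rewrite /= sqrrN. Qed.

Lemma le_normc_sum (I : Type) (s : seq I) (P : pred I) (F : I -> R[i]) :
  normc (\sum_(i <- s | P i) F i) <= \sum_(i <- s | P i) normc (F i).
Proof.
elim/big_ind2: _ => //; first by rewrite Normc.normc0.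
by move=> x a y b xa yb; rewrite (le_trans (le_normcD _ _))// lerD.
Qed.

End ComplexAux.

Section MeanC.
Context {R : realType} {d : nat}.
Implicit Types (f g : 'rV[R]_d -> R[i]) (k : 'rV[int]_d).

(** Bounded measurable complex functions. *)
Definition bmC f : Prop :=
  bm (fun x => complex.Re (f x)) /\ bm (fun x => complex.Im (f x)).

Lemma eq_bmC f g : f =1 g -> bmC g -> bmC f.
Proof. by move=> /funext ->. Qed.

Lemma bmC_cst c : bmC (fun=> c).
Proof. by split; exact: bm_cst. Qed.

Lemma bmCD f g : bmC f -> bmC g -> bmC (fun x => f x + g x).
Proof.
move=> [rf jf] [rg jg]; split.
  by apply: eq_bm (bmD rf rg) => x; rewrite Re_add.
by apply: eq_bm (bmD jf jg) => x; rewrite Im_add.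
Qed.

Lemma bmCM f g : bmC f -> bmC g -> bmC (fun x => f x * g x).
Proof.
move=> [rf jf] [rg jg]; split.
  by apply: eq_bm (bmB (bmM rf rg) (bmM jf jg)) => x; rewrite Re_mul.
by apply: eq_bm (bmD (bmM rf jg) (bmM jf rg)) => x; rewrite Im_mul.
Qed.

Lemma bmC_sum (I : Type) (s : seq I) (P : pred I) (F : I -> 'rV[R]_d -> R[i]) :
  (forall i, P i -> bmC (F i)) -> bmC (fun x => \sum_(i <- s | P i) F i x).
Proof.
move=> bF; elim: s => [|i s IH].
  by apply: eq_bmC (bmC_cst 0) => x; rewrite big_nil.
have [Pi|nPi] := boolP (P i); last first.
  by apply: eq_bmC IH => x; rewrite big_cons (negbTE nPi).
by apply: eq_bmC (bmCD (bF i Pi) IH) => x; rewrite big_cons Pi.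
Qed.

Lemma bm_normc f : bmC f -> bm (fun x => normc (f x)).
Proof.
move=> [rf jf].
have bs : bm (fun x => complex.Re (f x) ^+ 2 + complex.Im (f x) ^+ 2).
  by apply: bmD; apply: bmM.
apply: eq_bm (bm_powR (a := 2^-1) _ _ bs) => //.
- move=> x; rewrite powR12_sqrt ?addr_ge0 ?sqr_ge0//.
  by case: (f x).
- by move=> x; rewrite addr_ge0 ?sqr_ge0.
Qed.

Lemma bmC_char k : bmC (character k).
Proof.
have ms : measurable_fun setT (fun t : d.-tuple (measurableTypeR R) =>
    \sum_j (k 0 j)%:~R * (row_of_tuple t) 0 j).
  apply: measurable_sum => j; apply: measurable_funM => //.
  rewrite (_ : (fun _ => _) = (fun t => tnth t j)); last first.
    by apply/funext => t; rewrite mxE.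
  exact: measurable_tnth.
split; split => /=.
- exact: measurableT_comp (continuous_measurable_fun (@continuous_cos R)) ms.
- by exists 1 => x; rewrite ler_norml cos_geN1 cos_le1.
- exact: measurableT_comp (continuous_measurable_fun (@continuous_sin R)) ms.
- by exists 1 => x; rewrite ler_norml sin_geN1 sin_le1.
Qed.

Lemma eq_integralC f g : f =1 g -> integralC f = integralC g.
Proof. by move=> /funext ->. Qed.

Lemma integralCE f : integralC f =
  mean (fun x => complex.Re (f x)) +i* mean (fun x => complex.Im (f x)).
Proof. by []. Qed.

Lemma integralCD f g : bmC f -> bmC g ->
  integralC (fun x => f x + g x) = integralC f + integralC g.
Proof.
move=> [rf jf] [rg jg]; apply: complex_ext; rewrite ?Re_add ?Im_add !integralCE /=.
  rewrite -meanD//; apply: eq_mean => x; exact: Re_add.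
rewrite -meanD//; apply: eq_mean => x; exact: Im_add.
Qed.

Lemma integralCZ c f : bmC f ->
  integralC (fun x => c * f x) = c * integralC f.
Proof.
move=> [rf jf]; apply: complex_ext; rewrite ?Re_mul ?Im_mul !integralCE /=.
  rewrite -!meanZ// -meanB; [|exact: bmZ|exact: bmZ].
  by apply: eq_mean => x; exact: Re_mul.
rewrite -!meanZ// -meanD; [|exact: bmZ|exact: bmZ].
by apply: eq_mean => x; exact: Im_mul.
Qed.

Lemma integralC_sum (I : Type) (s : seq I) (P : pred I)
    (F : I -> 'rV[R]_d -> R[i]) :
  (forall i, P i -> bmC (F i)) ->
  integralC (fun x => \sum_(i <- s | P i) F i x) =
  \sum_(i <- s | P i) integralC (F i).
Proof.
move=> bF; elim: s => [|i s IH].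
  rewrite big_nil (@eq_integralC _ (fun=> 0)); last by move=> x; rewrite big_nil.
  by rewrite integralCE /= !mean_cst.
rewrite big_cons -IH; case: ifPn => Pi; last first.
  by apply: eq_integralC => x; rewrite big_cons (negbTE Pi).
rewrite -integralCD; [|exact: bF|exact: bmC_sum].
by apply: eq_integralC => x; rewrite big_cons Pi.
Qed.

Lemma integralC_char k : integralC (character k) = (k == 0)%:R :> R[i].
Proof.
have [c s] := @Rint_torus_cos_sin R d (fun j => k 0 j).
have -> : (k == 0) = [forall j, k 0 j == 0].
  apply/eqP/forallP => [-> j|k0]; first by rewrite mxE.
  by apply/rowP => j; rewrite mxE; apply/eqP.
have sE (t : d.-tuple (measurableTypeR R)) :
    \sum_j (k 0 j)%:~R * (row_of_tuple t) 0 j = \sum_j (k 0 j)%:~R * tnth t j.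
  by apply: eq_bigr => j _; rewrite mxE.
apply: complex_ext => /=.
  under eq_Rintegral do rewrite sE.
  by rewrite c; case: [forall j, _].
under eq_Rintegral do rewrite sE.
by rewrite s; case: [forall j, _].
Qed.

Lemma character_expi k (x : 'rV[R]_d) :
  character k x = expi (\sum_j (k 0 j)%:~R * x 0 j).
Proof. by []. Qed.

Lemma characterD k l (x : 'rV[R]_d) :
  character (k + l) x = character k x * character l x.
Proof.
rewrite !character_expi -expiD -big_split/=; congr expi.
by apply: eq_bigr => j _; rewrite mxE intrD mulrDl.
Qed.

Lemma characterDr k (x y : 'rV[R]_d) :
  character k (x + y) = character k x * character k y.
Proof.
rewrite !character_expi -expiD -big_split/=; congr expi.
by apply: eq_bigr => j _; rewrite mxE mulrDr.
Qed.

Lemma character0r k : character k (0 : 'rV[R]_d) = 1.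
Proof.
rewrite character_expi big1 ?expi0// => j _; by rewrite mxE mulr0.
Qed.

Lemma characterN k (x : 'rV[R]_d) : character k (- x) = character (- k) x.
Proof.
rewrite !character_expi; congr expi; apply: eq_bigr => j _.
by rewrite !mxE rmorphN/= mulNr mulrN.
Qed.

Lemma character_conj k (x : 'rV[R]_d) :
  (character k x)^*%C = character (- k) x.
Proof.
rewrite !character_expi -expiN; congr expi; rewrite -sumrN.
by apply: eq_bigr => j _; rewrite !mxE rmorphN/= mulNr.
Qed.

Lemma normc_character k (x : 'rV[R]_d) : normc (character k x) = 1.
Proof. by rewrite character_expi normc_expi. Qed.

Lemma character_periodic k : periodic2pi (character k : 'rV[R]_d -> R[i]).
Proof.
move=> j x; rewrite characterDr [X in _ * X](_ : _ = 1) ?mulr1//.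
rewrite character_expi (bigD1 j)//= big1 ?addr0.
  by rewrite !mxE !eqxx mulr1 expi_2pi.
by move=> i ij; rewrite !mxE eqxx (negbTE ij)/= !mulr0.
Qed.

End MeanC.

(** * Trigonometric polynomials and their dyadic blocks *)

Lemma continuous_sumr (K : numFieldType) (V : normedModType K)
    (T : topologicalType) (I : Type) (s : seq I) (F : I -> T -> V) :
  (forall i, continuous (F i)) -> continuous (fun x => \sum_(i <- s) F i x).
Proof.
move=> cF; elim: s => [|i s IH].
  have -> : (fun x => \sum_(i <- [::]) F i x) = cst 0.
    by apply/funext => y; rewrite big_nil.
  exact: cst_continuous.
have -> : (fun x => \sum_(j <- i :: s) F j x) =
    (fun x => F i x + \sum_(j <- s) F j x).
  by apply/funext => y; rewrite big_cons.
by move=> x; apply: cvgD; [exact: cF|exact: IH].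
Qed.

Section Trig.
Context {R : realType} {d : nat}.
Implicit Types (f g : 'rV[R]_d -> R[i]) (k : 'rV[int]_d)
  (l : seq (R[i] * 'rV[int]_d)) (S : set 'rV[int]_d).

Lemma continuous_expi : continuous (expi : R -> R[i]^o).
Proof.
move=> u; apply/cvgrPdist_lt => e e0.
have [e1 e10 eE] : exists2 e1 : R, 0 < e1 & e = e1%:C.
  case: e e0 => a b; rewrite ltcE /= => /andP[/eqP -> a0].
  by exists a.
have e2 : 0 < e1 / 2 by rewrite divr_gt0.
have /cvgrPdist_lt/(_ _ e2) cc := @continuous_cos R u.
have /cvgrPdist_lt/(_ _ e2) cs := @continuous_sin R u.
move: cc cs; apply: filterS2 => v cc cs.
rewrite eE normc_def ltcR /=.
have h : forall a b : R, Num.sqrt (a ^+ 2 + b ^+ 2) <= `|a| + `|b|.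
  move=> a b; rewrite -[leRHS]ger0_norm ?addr_ge0//.
  rewrite -[leRHS]sqrtr_sqr ler_wsqrtr// sqrrD !real_normK ?num_real//.
  by rewrite addrAC lerDl mulrn_wge0// mulr_ge0.
apply: le_lt_trans (h _ _) _; by rewrite [ltRHS]splitr ltrD.
Qed.

Lemma continuous_character k :
  continuous (character k : 'rV[R]_d -> R[i]^o).
Proof.
move=> x; pose u (x : 'rV[R]_d) := \sum_j (k 0 j)%:~R * x 0 j.
apply: (@continuous_comp _ _ _ u (expi : R -> R[i]^o)); last exact: continuous_expi.
apply: (continuous_sumr (F := fun j (x : 'rV[R]_d) => (k 0 j)%:~R * x 0 j : R)).
by move=> j y; exact: (cvgMl_tmp (@coord_continuous R 1 d 0 j y)).
Qed.

(** The trigonometric polynomial with coefficients and frequencies listed in [l];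
    a frequency may occur several times. *)
Definition trig l (x : 'rV[R]_d) : R[i] :=
  \sum_(a <- l) a.1 * character a.2 x.

(** [f] is a trigonometric polynomial with frequencies in [S]. *)
Definition has_spec S f : Prop :=
  exists2 l, (forall a, a \in l -> S a.2) & f =1 trig l.

Lemma eq_has_spec S f g : f =1 g -> has_spec S g -> has_spec S f.
Proof. by move=> /funext ->. Qed.

Lemma sub_has_spec S S' f : S `<=` S' -> has_spec S f -> has_spec S' f.
Proof. by move=> SS [l Sl fl]; exists l => // a /Sl /SS. Qed.

Lemma has_spec_bmC S f : has_spec S f -> bmC f.
Proof.
move=> [l _ /eq_bmC]; apply; apply: bmC_sum => a _.
apply: bmCM; [exact: bmC_cst|exact: bmC_char].
Qed.

Lemma has_spec_continuous S f : has_spec S f ->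
  continuous (f : 'rV[R]_d -> R[i]^o).
Proof.
move=> [l _ /funext ->]; rewrite /trig.
apply: (continuous_sumr
  (F := fun a (x : 'rV[R]_d) => a.1 * character a.2 x : R[i]^o)).
by move=> a y; exact: (cvgMl_tmp (@continuous_character a.2 y)).
Qed.

Lemma has_spec_periodic S f : has_spec S f -> periodic2pi f.
Proof.
move=> [l _ /funext ->] j x; apply: eq_bigr => a _; congr (_ * _).
exact: (@character_periodic R d a.2 j).
Qed.

Lemma has_spec_bounded S f : has_spec S f -> exists M : R, forall x, normc (f x) <= M.
Proof.
move=> [l _ fl]; exists (\sum_(a <- l) normc a.1) => x.
rewrite fl (le_trans (le_normc_sum _ _ _))//; apply: ler_sum => a _.
by rewrite Normc.normcM normc_character mulr1.
Qed.

Lemma has_specZ S c f : has_spec S f -> has_spec S (fun x => c * f x).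
Proof.
move=> [l Sl fl]; exists [seq (c * a.1, a.2) | a <- l].
  by move=> _ /mapP[a al ->] /=; exact: Sl.
move=> x; rewrite fl /trig big_map big_distrr/=.
by apply: eq_bigr => a _; rewrite mulrA.
Qed.

Lemma has_spec_char S k : S k -> has_spec S (character k).
Proof.
move=> Sk; exists [:: (1, k)].
  by move=> a; rewrite inE => /eqP ->.
by move=> x; rewrite /trig big_seq1 mul1r.
Qed.

Lemma has_spec_sum S (I : eqType) (s : seq I) (F : I -> 'rV[R]_d -> R[i]) :
  (forall i, i \in s -> has_spec S (F i)) ->
  has_spec S (fun x => \sum_(i <- s) F i x).
Proof.
elim: s => [|i s IH] sF.
  by exists [::] => // x; rewrite /trig !big_nil.
have [l Sl fl] := sF i (mem_head _ _).
have [|l' Sl' fl'] := IH; first by move=> j js; apply: sF; rewrite inE js orbT.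
exists (l ++ l').
  by move=> a; rewrite mem_cat => /orP[/Sl|/Sl'].
by move=> x; rewrite big_cons fl fl' /trig big_cat.
Qed.

Lemma has_specM S1 S2 S f g :
  (forall k1 k2, S1 k1 -> S2 k2 -> S (k1 + k2)) ->
  has_spec S1 f -> has_spec S2 g -> has_spec S (fun x => f x * g x).
Proof.
move=> SS [l Sl fl] [l' Sl' fl'].
exists [seq (a.1 * b.1, a.2 + b.2) | a <- l, b <- l'].
  by move=> _ /allpairsP[[a b] [/= al bl ->]] /=; apply: SS; [exact: Sl|exact: Sl'].
move=> x; rewrite fl fl' /trig big_allpairs_dep/= big_distrl/=.
apply: eq_bigr => a _; rewrite big_distrr/=; apply: eq_bigr => b _.
by rewrite characterD mulrACA.
Qed.

Lemma fourier_character k k' :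
  fourier (character k : 'rV[R]_d -> R[i]) k' = (k == k')%:R.
Proof.
rewrite /fourier -subr_eq0 -integralC_char.
by apply: eq_integralC => x; rewrite characterD.
Qed.

Lemma fourier_sum (I : Type) (s : seq I) (F : I -> 'rV[R]_d -> R[i]) k :
  (forall i, bmC (F i)) ->
  fourier (fun x => \sum_(i <- s) F i x) k = \sum_(i <- s) fourier (F i) k.
Proof.
move=> bF; rewrite /fourier -integralC_sum; last first.
  by move=> i _; apply: bmCM => //; exact: bmC_char.
by apply: eq_integralC => x; rewrite big_distrl.
Qed.

Lemma fourierZ c f k : bmC f ->
  fourier (fun x => c * f x) k = c * fourier f k.
Proof.
move=> bf; rewrite /fourier -integralCZ; last by apply: bmCM => //; exact: bmC_char.
by apply: eq_integralC => x; rewrite mulrA.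
Qed.

Lemma fourier_trig l k :
  fourier (trig l) k = \sum_(a <- l | a.2 == k) a.1.
Proof.
rewrite fourier_sum; last first.
  by move=> a; apply: bmCM; [exact: bmC_cst|exact: bmC_char].
rewrite [RHS]big_mkcond/=; apply: eq_bigr => a _.
rewrite fourierZ; last exact: bmC_char.
by rewrite fourier_character; case: eqP; rewrite ?mulr1 ?mulr0.
Qed.

Lemma fourier_has_spec0 S f k : has_spec S f -> ~ S k -> fourier f k = 0.
Proof.
move=> [l Sl /funext ->] nS; rewrite fourier_trig big_seq_cond big1//.
by move=> a /andP[/Sl Sa /eqP ak]; rewrite ak in Sa.
Qed.

Lemma deltaE s f x :
  delta s f x = \sum_(k <- fset_set (rho s)) fourier f k * character k x.
Proof. by rewrite /delta fsbig_finite//; exact: finite_rho. Qed.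

Lemma delta_sum (I : Type) (s : seq I) (F : I -> 'rV[R]_d -> R[i]) t x :
  (forall i, bmC (F i)) ->
  delta t (fun x => \sum_(i <- s) F i x) x = \sum_(i <- s) delta t (F i) x.
Proof.
move=> bF; rewrite deltaE.
under [RHS]eq_bigr do rewrite deltaE.
rewrite exchange_big/=; apply: eq_bigr => k _.
by rewrite fourier_sum// big_distrl.
Qed.

Lemma delta_disjoint S s f x : has_spec S f -> (forall k, S k -> ~ rho s k) ->
  delta s f x = 0.
Proof.
move=> fS Srho; rewrite deltaE big_seq big1// => k.
rewrite in_fset_set; last exact: finite_rho.
rewrite inE => rk.
by rewrite (@fourier_has_spec0 S)// ?mul0r// => /Srho.
Qed.

Lemma delta_id S s f x : has_spec S f -> S `<=` rho s -> delta s f x = f x.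
Proof.
move=> [l Sl /funext ->] Srho; rewrite deltaE.
under eq_bigr do rewrite fourier_trig.
under eq_bigr do rewrite big_distrl/= big_mkcond/=.
rewrite exchange_big/=; rewrite /trig big_seq [RHS]big_seq.
apply: eq_bigr => a al.
rewrite -big_mkcond/= (big_rem a.2) /=; last first.
  by rewrite in_fset_set ?inE; [exact: Srho (Sl _ al)|exact: finite_rho].
rewrite eqxx big_seq_cond big1 ?addr0// => k /andP[].
rewrite mem_rem_uniq ?fset_uniq// inE => /andP[/negP ka _] /eqP ak.
by case: ka; rewrite ak.
Qed.

End Trig.

(** * Dirichlet kernels of boxes *)

Section Box.
Context {d : nat}.
Implicit Types (N : 'I_d -> nat) (k : 'rV[int]_d).

(** The integer vectors [k] with [0 <= k_j < N_j], listed without repetition. *)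
Definition box N : seq 'rV[int]_d :=
  [seq \row_j ((phi j : nat)%:Z) | phi : {ffun 'I_d -> 'I_(\max_j N j)} <-
     enum (family (fun j => [pred i : 'I_(\max_j N j) | (i < N j)%N]))].

Lemma mem_boxP N k :
  reflect (forall j, (0 <= k 0 j < (N j)%:Z)%R) (k \in box N).
Proof.
apply: (iffP mapP) => [[phi + ->] j|kN].
  by rewrite mem_enum => /familyP/(_ j); rewrite inE mxE => h; rewrite ltz_nat h.
have aN j : (absz (k 0%R j) < N j)%N by have := kN j; lia.
have aM j : (absz (k 0%R j) < \max_j N j)%N.
  exact: leq_trans (aN j) (leq_bigmax (F := N) j).
exists [ffun j => Ordinal (aM j)].
  by rewrite mem_enum; apply/familyP => j; rewrite inE ffunE /=.
by apply/rowP => j; rewrite mxE ffunE /=; have := kN j; lia.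
Qed.

Lemma box_uniq N : uniq (box N).
Proof.
rewrite map_inj_uniq ?enum_uniq// => f g /rowP fg.
by apply/ffunP => j; apply/val_inj; have := fg j; rewrite !mxE => -[].
Qed.

Lemma size_box N : size (box N) = (\prod_j N j)%N.
Proof.
rewrite size_map -cardE card_family foldrE big_map big_enum /=.
apply: eq_bigr => j _.
rewrite -sum1_card (eq_bigl (fun i : 'I_(\max_j N j) => (i < N j)%N)); last first.
  by move=> i.
by rewrite -(big_ord_widen _ (fun=> 1%N)) ?sum1_card ?card_ord// (leq_bigmax (F := N)).
Qed.

(** In a pair with a given sum, each coordinate of one component determines that
    of the other, so it may be counted in the smaller of the two ranges. *)
Lemma count_pair_box N N' k :
  (count (fun ab : 'rV[int]_d * 'rV[int]_d => (ab.1 + ab.2)%R == k)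
     [seq (a, b) | a <- box N, b <- box N'] <= \prod_j minn (N j) (N' j))%N.
Proof.
pose M j := minn (N j) (N' j).
(* [phi] keeps, in each coordinate, the component with the smaller range. *)
rewrite -(size_box M) -size_filter.
pose phi (ab : 'rV[int]_d * 'rV[int]_d) : 'rV[int]_d :=
  \row_j if (N j <= N' j)%N then ab.1 0 j else ab.2 0 j.
rewrite -(size_map phi); apply: uniq_leq_size.
  rewrite map_inj_in_uniq.
    by rewrite filter_uniq// allpairs_uniq ?box_uniq// => -[a b] [a' b'] _ _ [-> ->].
  move=> [a b] [a' b']; rewrite !mem_filter => /andP[/eqP/= + _] /andP[/eqP/= + _].
  move=> /rowP ab /rowP ab' /rowP pE.
  have E j : a 0 j = a' 0 j /\ b 0 j = b' 0 j.
    have := ab j; have := ab' j; have := pE j; rewrite !mxE /=.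
    by case: ifP => _; lia.
  by congr pair; apply/rowP => j; have [] := E j.
move=> _ /mapP[[a b] + ->]; rewrite mem_filter => /andP[_ /allpairsP[[a' b'] /= [+ + [-> ->]]]].
move=> /mem_boxP aN /mem_boxP bN; apply/mem_boxP => j; rewrite mxE /= /M.
by have := aN j; have := bN j; case: ifP; lia.
Qed.

End Box.

Section Parseval.
Context {R : realType} {d : nat}.
Implicit Types (N : 'I_d -> nat) (l : seq (R[i] * 'rV[int]_d)) (x y : 'rV[R]_d).

(** Parseval's identity for coefficients of modulus at most 1; since frequencies
    may be repeated, it becomes a count of the pairs of equal frequencies. *)
Lemma mean_normc_sq_le l : (forall a, a \in l -> normc a.1 <= 1) ->
  mean (fun x => normc (trig l x) ^+ 2) <=
    \sum_(a <- l) (count (fun b => b.2 == a.2) l)%:R.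
Proof.
move=> l1.
have bch (c : R[i]) (k : 'rV[int]_d) : bmC (fun x => c * character k x).
  by apply: bmCM; [exact: bmC_cst|exact: bmC_char].
pose F x : R[i] := \sum_(a <- l) \sum_(b <- l) (a.1 * b.1^*%C) * character (a.2 - b.2) x.
have FE x : F x = trig l x * (trig l x)^*%C.
  rewrite /trig big_distrl/=; apply: eq_bigr => a _.
  rewrite conjc_sum big_distrr/=; apply: eq_bigr => b _.
  by rewrite conjc_mul character_conj characterD mulrACA.
have -> : mean (fun x => normc (trig l x) ^+ 2) = complex.Re (integralC F).
  by rewrite integralCE; apply: eq_mean => x; rewrite FE normc_sqE.
have -> : integralC F =
    \sum_(a <- l) \sum_(b <- l) (a.1 * b.1^*%C) * (a.2 == b.2)%:R.
  rewrite integralC_sum; last by move=> a _; apply: bmC_sum => b _; exact: bch.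
  apply: eq_bigr => a _; rewrite integralC_sum; last by move=> b _; exact: bch.
  apply: eq_bigr => b _; rewrite integralCZ; last exact: bmC_char.
  by rewrite integralC_char subr_eq0.
apply: le_trans (Re_le_normc _) _; apply: le_trans (le_normc_sum _ _ _) _.
rewrite big_seq [leRHS]big_seq; apply: ler_sum => a al.
apply: le_trans (le_normc_sum _ _ _) _.
rewrite -sum1_count natr_sum [leRHS]big_mkcond/= big_seq [leRHS]big_seq.
apply: ler_sum => b bl; rewrite eq_sym; case: eqP => _; last by rewrite mulr0 Normc.normc0.
rewrite mulr1 Normc.normcM mulr_ile1 ?normc_ge0 ?l1//.
by rewrite normc_conj l1.
Qed.

(** The Dirichlet kernel of a box. *)
Definition dirichlet N x : R[i] := \sum_(k <- box N) character k x.

Lemma dirichletB N y x : dirichlet N (y - x) =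
  \sum_(k <- box N) character k y * character (- k) x.
Proof. by apply: eq_bigr => k _; rewrite characterDr characterN. Qed.

Lemma dirichlet_trig N y x : dirichlet N (y - x) =
  trig [seq (character k y, - k) | k <- box N] x.
Proof.
by rewrite dirichletB /trig [RHS]big_map.
Qed.

Lemma normc_dirichletN N x : normc (dirichlet N (- x)) = normc (dirichlet N x).
Proof.
have -> : dirichlet N (- x) = (dirichlet N x)^*%C.
  rewrite /dirichlet conjc_sum; apply: eq_bigr => k _.
  by rewrite characterN character_conj.
exact: normc_conj.
Qed.

Lemma normc_dirichlet_le N x : normc (dirichlet N x) <= (\prod_j N j)%:R.
Proof.
apply: le_trans (le_normc_sum _ _ _) _.
rewrite -size_box -sum1_size natr_sum; apply: ler_sum => k _.
by rewrite normc_character.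
Qed.

Lemma dirichlet0 N : dirichlet N 0 = (\prod_j N j)%:R.
Proof.
rewrite /dirichlet -size_box -sum1_size natr_sum; apply: eq_bigr => k _.
by rewrite character0r.
Qed.

Lemma mean_dirichlet_sq N y :
  mean (fun x => normc (dirichlet N (y - x)) ^+ 2) <= (\prod_j N j)%:R.
Proof.
under eq_mean do rewrite dirichlet_trig.
apply: le_trans (mean_normc_sq_le _) _.
  by move=> _ /mapP[k _ ->]; rewrite normc_character.
rewrite -size_box -sum1_size natr_sum big_map big_seq [leRHS]big_seq.
apply: ler_sum => k kN; rewrite ler_nat count_map.
rewrite (eq_count (a2 := pred1 k)); last by move=> j /=; rewrite eqr_opp.
by rewrite count_uniq_mem ?box_uniq// kN.
Qed.

Lemma mean_dirichlet_pair N N' y y' :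
  mean (fun x => (normc (dirichlet N (y - x)) * normc (dirichlet N' (y' - x))) ^+ 2)
  <= ((\prod_j N j) * (\prod_j N' j) * \prod_j minn (N j) (N' j))%:R.
Proof.
pose L := [seq (a, b) | a <- box N, b <- box N'].
pose l := [seq (character ab.1 y * character ab.2 y', - (ab.1 + ab.2)) | ab <- L].
have E x : dirichlet N (y - x) * dirichlet N' (y' - x) = trig l x.
  rewrite !dirichletB /trig /l [RHS]big_map big_allpairs big_distrl/=.
  apply: eq_bigr => a _; rewrite big_distrr/=; apply: eq_bigr => b _.
  by rewrite opprD characterD mulrACA.
under eq_mean do rewrite -Normc.normcM E.
apply: le_trans (mean_normc_sq_le _) _.
  by move=> _ /mapP[k _ ->]; rewrite Normc.normcM !normc_character mulr1.
have -> : ((\prod_j N j) * (\prod_j N' j))%N = size L.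
  by rewrite size_allpairs !size_box.
rewrite natrM big_map.
rewrite -sum1_size natr_sum big_distrl/=; apply: ler_sum => -[a b] _.
rewrite mul1r ler_nat count_map; apply: leq_trans (count_pair_box N N' (a + b)).
by apply: sub_count => -[a' b'] /=; rewrite eqr_opp.
Qed.

End Parseval.

(** * Powers of sums of almost orthogonal functions *)

Lemma powR_pred (R : realType) (z a : R) : 0 < z -> z `^ a = z `^ (a - 1) * z.
Proof.
move=> z0; rewrite -{3}[z]powRr1 ?ltW// -powRD ?subrK//.
by rewrite (gt_eqF z0) implybT.
Qed.

Section AlmostOrthogonal.
Context {R : realType} {d : nat}.

(** With [h m] the largest term, [h j ^ u <= h j * h m ^ (u - 1)], and the
    factors [2 ^ (- e D)] make the sum over [j] converge. *)
Lemma sum_le_pairs (I : finType) (h : I -> R) (D : I -> I -> R) (u e K : R) :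
  1 < u -> 0 <= K -> (forall i, 0 <= h i) ->
  (forall i, \sum_j 2 `^ (- (e * D i j)) <= K) ->
  (\sum_i h i) `^ u <=
  K `^ u * \sum_i \sum_j 2 `^ (e * u * D i j) * (h j * h i `^ (u - 1)).
Proof.
move=> u1 K0 h0 hK.
have u0 : 0 < u by lra.
have g0 : 0 < u - 1 by lra.
set G := \sum_i _.
have T0 i j : 0 <= 2 `^ (e * u * D i j) * (h j * h i `^ (u - 1)).
  by rewrite mulr_ge0 ?powR_ge0// mulr_ge0 ?powR_ge0.
have G0 : 0 <= G by apply: sumr_ge0 => i _; apply: sumr_ge0 => j _.
suff main : \sum_i h i <= K * G `^ u^-1.
  have -> : K `^ u * G = (K * G `^ u^-1) `^ u.
    by rewrite powRM ?powR_ge0// -powRrM mulVf ?gt_eqF// powRr1.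
  rewrite ge0_ler_powR ?nnegrE ?(ltW u0)//; first exact: sumr_ge0.
  by rewrite mulr_ge0 ?powR_ge0.
have [i0 _|I0] := pickP I; last first.
  by rewrite big_pred0 ?mulr_ge0 ?powR_ge0// => i; have := I0 i.
(* [m] is the index of the largest term. *)
have [m _ hm] := @arg_maxP _ _ _ i0 xpredT h isT.
have step j : h j <= 2 `^ (- (e * D m j)) * G `^ u^-1.
  have hle : 2 `^ (e * u * D m j) * (h j * h m `^ (u - 1)) <= G.
    rewrite /G (bigD1 m)//= (bigD1 j)//= -addrA lerDl addr_ge0//.
      by apply: sumr_ge0.
    by apply: sumr_ge0 => i _; apply: sumr_ge0 => j' _.
  have hju : h j `^ u <= h j * h m `^ (u - 1).
    have -> : h j `^ u = h j * h j `^ (u - 1).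
      have [->|hj] := eqVneq (h j) 0; first by rewrite powR0 ?mul0r// gt_eqF.
      have hp : 0 < h j by rewrite lt0r hj h0.
      by rewrite (powR_pred _ hp) mulrC.
    by rewrite ler_wpM2l// ge0_ler_powR ?nnegrE ?(ltW g0)//; exact: hm.
  have -> : h j = 2 `^ (- (e * D m j)) * (2 `^ (e * u * D m j) * h j `^ u) `^ u^-1.
    rewrite powRM ?powR_ge0// -!powRrM divff ?gt_eqF// powRr1// mulrA.
    rewrite -powRD; last by rewrite pnatr_eq0 implybT.
    by rewrite [X in _ `^ X](_ : _ = 0) ?powRr0 ?mul1r//; field; rewrite gt_eqF.
  rewrite ler_wpM2l ?powR_ge0// ge0_ler_powR ?nnegrE ?invr_ge0 ?(ltW u0)//.
    by rewrite mulr_ge0 ?powR_ge0.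
  by apply: le_trans hle; rewrite ler_wpM2l ?powR_ge0.
apply: le_trans (ler_sum _ (fun j _ => step j)) _.
by rewrite -big_distrl/= ler_wpM2r ?powR_ge0.
Qed.

(** A substitute for Hoelder's inequality: a power of [z] is bounded by an affine
    function of [z] whose two terms are equal at [z = mu]. *)
Lemma powR_le_linear (z mu g : R) : 0 <= z <= 1 -> 0 < mu -> 0 < g ->
  z `^ g <= mu `^ (Num.min g 1) + mu `^ (Num.min g 1 - 1) * z.
Proof.
move=> /andP[z0 z1] mu0 g0; set g' := Num.min g 1.
have g'0 : 0 < g' by rewrite lt_min g0 ltr01.
have g'1 : g' <= 1 by rewrite ge_min lexx orbT.
have [->|zn0] := eqVneq z 0.
  by rewrite powR0 ?gt_eqF// mulr0 addr0 powR_ge0.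
have zp : 0 < z by rewrite lt0r zn0.
have zg : z `^ g <= z `^ g' by apply: ger_powR; rewrite ?zp ?z1 ?ge_min ?lexx.
apply: le_trans zg _; have [zmu|muz] := leP z mu.
  rewrite -[leLHS]addr0 lerD//; last by rewrite mulr_ge0 ?powR_ge0.
  by rewrite ge0_ler_powR ?nnegrE// ltW.
rewrite -[leLHS]add0r lerD ?powR_ge0//.
rewrite powR_pred// ler_wpM2r//.
have -> : g' - 1 = - (1 - g') by ring.
rewrite !powRN lef_pV2 ?posrE ?powR_gt0//.
by rewrite ge0_ler_powR ?nnegrE ?(ltW mu0) ?(ltW muz) ?subr_ge0.
Qed.

(** Nonnegative functions of height [S] and mean of order 1 whose pairwise
    products have means that decay with a distance [D] behave, in [L_u], as if
    their supports were disjoint. *)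
Lemma mean_sum_powR (I : finType) (h : I -> 'rV[R]_d -> R) (D : I -> I -> R)
    (u C S K : R) :
  let e := Num.min (u - 1) 1 / (2 * u) in
  1 < u -> 1 <= C -> 0 < S -> 0 <= K ->
  (forall i, bm (h i)) -> (forall i x, 0 <= h i x) ->
  (forall i x, h i x <= C * S) -> (forall i, mean (h i) <= C) ->
  (forall i j, mean (fun x => h i x * h j x) <= C * S * 2 `^ (- D i j)) ->
  (forall i j, 0 <= D i j) ->
  (forall i, \sum_j 2 `^ (- (e * D i j)) <= K) ->
  mean (fun x => (\sum_i h i x) `^ u) <=
  K `^ u * (C * S) `^ (u - 1) * (C + 1) * K * #|I|%:R.
Proof.
move=> e; set g := u - 1 in e *; set g' := Num.min g 1 in e *.
move=> u1 C1 S0 K0 bh h0 hS hC hp D0 hK.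
have u0 : 0 < u by lra.
have g0 : 0 < g by rewrite subr_gt0.
have C0 : 0 < C by lra.
have g'0 : 0 < g' by rewrite lt_min g0 ltr01.
have CS0 : 0 < C * S by rewrite mulr_gt0.
have bp i j : bm (fun x => h j x * h i x `^ g).
  by apply: bmM => //; apply: bm_powR => //; exact: ltW.
have pair i j : mean (fun x => h j x * h i x `^ g) <=
    (C * S) `^ g * (C + 1) * 2 `^ (- (g' * D i j)).
  (* This [mu] balances the two terms of [powR_le_linear] in the mean. *)
  set mu := 2 `^ (- D i j); have mu0 : 0 < mu by rewrite powR_gt0.
  have pw x : h j x * h i x `^ g <= (C * S) `^ g *
      (mu `^ g' * h j x + (mu `^ (g' - 1) / (C * S)) * (h i x * h j x)).
    set z := h i x / (C * S).
    have z01 : 0 <= z <= 1.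
      by rewrite divr_ge0 ?(ltW CS0)//= ler_pdivrMr ?mul1r.
    have -> : h i x = C * S * z by rewrite /z mulrC divfK ?gt_eqF.
    rewrite powRM ?(ltW CS0)//; last by case/andP: z01.
    rewrite mulrCA ler_wpM2l ?powR_ge0//.
    have -> : mu `^ (g' - 1) / (C * S) * (C * S * z * h j x) =
       h j x * (mu `^ (g' - 1) * z) by field; rewrite !gt_eqF.
    by rewrite [X in _ <= X + _]mulrC -mulrDr ler_wpM2l// powR_le_linear.
  have bpr : bm (fun x => h i x * h j x) by exact: bmM.
  apply: le_trans (le_mean (bp i j) _ pw) _.
    by apply: bmZ; apply: bmD; exact: bmZ.
  rewrite meanZ; last by apply: bmD; exact: bmZ.
  rewrite meanD; [|exact: bmZ|exact: bmZ].
  rewrite !meanZ// -[leRHS]mulrA ler_wpM2l ?powR_ge0//.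
  have muE : mu `^ g' = 2 `^ (- (g' * D i j)) by rewrite /mu -powRrM mulNr mulrC.
  rewrite -muE mulrDl mul1r; apply: lerD.
    by rewrite mulrC ler_wpM2r ?powR_ge0.
  have -> : mu `^ g' = mu `^ (g' - 1) / (C * S) * (C * S * mu).
    have -> : mu `^ (g' - 1) / (C * S) * (C * S * mu) = mu `^ (g' - 1) * mu.
      by field; rewrite !gt_eqF.
    exact: powR_pred.
  by rewrite ler_wpM2l// divr_ge0 ?powR_ge0// ltW.
have bF : bm (fun x => (\sum_i h i x) `^ u).
  apply: bm_powR; [exact: ltW| |exact: bm_sum].
  by move=> x; exact: sumr_ge0.
have bT i j : bm (fun x => 2 `^ (e * u * D i j) * (h j x * h i x `^ g)).
  exact: bmZ.
apply: le_trans (le_mean bF _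
  (fun x => sum_le_pairs (h := h^~ x) u1 K0 (fun i => h0 i x) hK)) _.
  by apply: bmZ; apply: bm_sum => i _; apply: bm_sum => j _.
rewrite meanZ; last by apply: bm_sum => i _; apply: bm_sum => j _.
rewrite -![leRHS]mulrA ler_wpM2l ?powR_ge0//.
rewrite mean_sum; last by move=> i _; apply: bm_sum => j _.
have eu : e * u = g' / 2 by rewrite /e; field; rewrite gt_eqF.
have eg : e <= g' / 2.
  by rewrite -eu ler_peMr ?(ltW u1)// divr_ge0 ?(ltW g'0) ?mulr_ge0 ?(ltW u0).
pose A := (C * S) `^ g * (C + 1).
have A0 : 0 <= A by rewrite mulr_ge0 ?powR_ge0 ?addr_ge0 ?(ltW C0).
suff row i : mean (fun x => \sum_j 2 `^ (e * u * D i j) * (h j x * h i x `^ g)) <= A * K.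
  apply: le_trans (ler_sum _ (fun i _ => row i)) _.
  by rewrite sumr_const -[leLHS]mulr_natr /A -!mulrA.
rewrite mean_sum; last by move=> j _; exact: bT.
apply: le_trans (ler_wpM2l A0 (hK i)); rewrite big_distrr/=.
apply: ler_sum => j _; rewrite meanZ//.
apply: le_trans (ler_wpM2l (powR_ge0 _ _) (pair i j)) _.
rewrite -/A mulrCA ler_wpM2l// -powRD; last by rewrite pnatr_eq0 implybT.
rewrite ler_powR ?ler1n// eu -mulrBl.
have -> : g' / 2 - g' = - (g' / 2) by field.
by rewrite mulNr lerN2 ler_wpM2r.
Qed.

End AlmostOrthogonal.

(** * Levels of equal length *)

Section Levels.
Context (d' n : nat).

(** The indices of the levels: all coordinates of a level but the first are chosen
    freely among the integers from 0 to [n / d], with [d = d' + 1]. *)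
Definition level_index := {ffun 'I_d' -> 'I_(n %/ d'.+1).+1}.
Implicit Types phi psi : level_index.

(** The level with given free coordinates; its first coordinate is the remainder
    that brings the sum to [n]. *)
Definition level phi (j : 'I_d'.+1) : nat :=
  if unlift ord0 j is Some i then phi i else (n - \sum_i phi i)%N.

Lemma level_lift phi i : level phi (lift ord0 i) = phi i.
Proof. by rewrite /level liftK. Qed.

Lemma norm1_level phi : norm1 (level phi) = n.
Proof.
rewrite /norm1 big_ord_recl (eq_bigr _ (fun i _ => level_lift phi i)).
rewrite /level unlift_none subnK//.
apply: (@leq_trans (\sum_(i < d') n %/ d'.+1)%N).
  by apply: leq_sum => i _; rewrite -ltnS.
rewrite sum_nat_const card_ord.
by apply: leq_trans (leq_trunc_div n d'.+1); rewrite mulnC leq_mul2l leqnSn orbT.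
Qed.

Lemma level_inj : injective level.
Proof.
move=> phi psi E; apply/ffunP => i; apply/val_inj.
by have := congr1 (fun f => f (lift ord0 i)) E; rewrite !level_lift.
Qed.

Lemma card_level_index : (n ^ d' <= d'.+1 ^ d' * #|{: level_index}|)%N.
Proof.
rewrite card_ffun !card_ord -expnMn.
case: d' => [|m]; first by rewrite !expn0.
by rewrite leq_exp2r// mulnC ltnW// ltn_ceil.
Qed.

(** Distance of two natural numbers. *)
Definition dist (a b : nat) : nat := (maxn a b - minn a b)%N.

Context {R : realType}.

(** Half of the [l_1]-distance of the free coordinates of two levels. *)
Definition level_dist phi psi : R := (\sum_i dist (phi i) (psi i))%N%:R / 2.

Lemma level_dist_ge0 phi psi : 0 <= level_dist phi psi.
Proof. by rewrite divr_ge0. Qed.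

Lemma prod_min_level phi psi :
  (\prod_j minn (2 ^ level phi j) (2 ^ level psi j))%N%:R <=
  2 ^+ n * 2 `^ (- level_dist phi psi) :> R.
Proof.
have mE a b : minn (2 ^ a) (2 ^ b) = (2 ^ minn a b)%N.
  by case: (leqP a b) => h; [apply/minn_idPl|apply/minn_idPr]; rewrite leq_exp2l// ltnW.
under eq_bigr do rewrite mE.
rewrite -expn_sum natrX -!powR_mulrn// -powRD; last by rewrite pnatr_eq0 implybT.
rewrite ler_powR ?ler1n// /level_dist lerBrDr -(ler_pM2r (ltr0n R 2)) mulrDl divfK//.
rewrite -!natrM -natrD ler_nat.
have S1 := norm1_level phi; have S2 := norm1_level psi; rewrite /norm1 in S1 S2.
rewrite [leqRHS](_ : _ = \sum_j (level phi j + level psi j))%N; last first.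
  by rewrite big_split/= S1 S2; lia.
rewrite [leqRHS](_ : _ = \sum_j (2 * minn (level phi j) (level psi j)) +
    \sum_j dist (level phi j) (level psi j))%N; last first.
  by rewrite -big_split/=; apply: eq_bigr => j _; rewrite /dist; lia.
rewrite -big_distrr/= mulnC leq_add2l [leqRHS]big_ord_recl.
rewrite (eq_bigr (fun i => dist (level phi (lift ord0 i))
  (level psi (lift ord0 i)))) ?leq_addl// => i _.
by rewrite !level_lift.
Qed.

(** A geometric series summed in both directions from [a]. *)
Lemma geom_dist (q : R) (M a : nat) : 0 <= q < 1 ->
  \sum_(i < M) q ^+ dist a i <= 2 / (1 - q).
Proof.
move=> /andP[q0 q1]; have p0 : 0 < 1 - q by rewrite subr_gt0.
have geo m : \sum_(i < m) q ^+ i <= (1 - q)^-1.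
  rewrite -[leRHS]mul1r ler_pdivlMr// mulrC -opprB mulNr -subrX1 opprB.
  by rewrite lerBlDr lerDl exprn_ge0.
have main : \sum_(i < M) q ^+ dist a i <= \sum_(i < a) q ^+ i.+1 + (1 - q)^-1.
  elim: a M => [|a IH] M.
    rewrite big_ord0 add0r; apply: le_trans (geo M); apply: ler_sum => i _.
    by rewrite /dist max0n min0n subn0.
  case: M => [|M].
    by rewrite big_ord0 addr_ge0 ?invr_ge0 ?(ltW p0)// sumr_ge0// => i _; rewrite exprn_ge0.
  rewrite big_ord_recl big_ord_recr/= addrAC addrC lerD//.
  apply: le_trans (IH M); apply: ler_sum => i _.
  by rewrite /dist /= /bump/= add1n maxnSS minnSS subSS.
apply: le_trans main _; rewrite mulr2n mulrDl mul1r lerD2r.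
apply: le_trans (geo a); apply: ler_sum => i _.
by rewrite exprS ler_piMl ?exprn_ge0 ?(ltW q1).
Qed.

Lemma sum_level_dist (e : R) phi : 0 < e ->
  \sum_psi 2 `^ (- (e * level_dist phi psi)) <= (2 / (1 - 2 `^ (- (e / 2)))) ^+ d'.
Proof.
move=> e0; set q := 2 `^ (- (e / 2)).
have q0 : 0 <= q by exact: powR_ge0.
have q1 : q < 1.
  rewrite /q powRN invf_lt1 ?powR_gt0//.
  have {1}<- : 1 `^ (e / 2) = 1 :> R by rewrite powR1.
  by rewrite gt0_ltr_powR ?nnegrE ?divr_gt0 ?ler01 ?ler0n ?ltr1n.
have E psi : 2 `^ (- (e * level_dist phi psi)) = \prod_i q ^+ dist (phi i) (psi i).
  rewrite prodrXr -powR_mulrn// /q -powRrM /level_dist; congr (_ `^ _).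
  by rewrite mulNr; congr (- _); rewrite mulrAC mulrA.
under eq_bigr do rewrite E.
rewrite -(bigA_distr_bigA (fun i k => q ^+ dist (phi i) (k : 'I_(n %/ d'.+1).+1))).
rewrite -[X in _ ^+ X]card_ord -prodr_const; apply: ler_prod => i _.
rewrite geom_dist ?q0 ?q1// andbT.
by apply: sumr_ge0 => k _; rewrite exprn_ge0.
Qed.

End Levels.

(** * Reproducing kernels *)

Section Kernel.
Context {R : realType} {d : nat}.
Implicit Types (s : 'I_d -> nat) (k : 'rV[int]_d) (x y : 'rV[R]_d).

(** The multiples [c * 2^(s_j)] of the side lengths of level [s]. *)
Definition dy s (c : nat) : 'I_d -> nat := fun j => (c * 2 ^ s j)%N.

(** The same multiples as a frequency vector. *)
Definition dyv s (c : nat) : 'rV[int]_d := \row_j (dy s c j)%:Z.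

(** The frequencies with [a * 2^(s_j) <= k_j < b * 2^(s_j)]. *)
Definition dyadic_box s (a b : nat) : set 'rV[int]_d :=
  [set k | forall j, (dy s a j)%:Z <= k 0%R j < (dy s b j)%:Z].

(** The number of frequencies in [dyadic_box s 0 1]. *)
Definition vol s : nat := (\prod_j 2 ^ s j)%N.

Lemma vol_gt0 s : (0 < vol s)%N.
Proof. by rewrite prodn_gt0// => j; rewrite expn_gt0. Qed.

Lemma volE s : vol s = (2 ^ norm1 s)%N.
Proof. by rewrite /vol -expn_sum. Qed.

Lemma prod_dy s c : (\prod_j dy s c j)%N = (c ^ d * vol s)%N.
Proof. by rewrite big_split/= prod_nat_const card_ord. Qed.

(** The reproducing kernel of level [s] centred at [y]. Its frequencies are the
    opposites of [8 P + a + b] with [a] in the box of sides [6 P_j] and [b] in the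
    box of sides [P_j]; when [9 P_j <= k_j < 14 P_j], each [b] gives exactly one
    representation of [k]. *)
Definition repkernel s y x : R[i] := (vol s)%:R^-1 *
  (character (dyv s 8) (y - x) *
   (dirichlet (dy s 6) (y - x) * dirichlet (dy s 1) (y - x))).

Lemma bmC_dirichlet N y : bmC (fun x => dirichlet N (y - x)).
Proof.
apply: eq_bmC (fun x => dirichletB N y x) _; apply: bmC_sum => k _.
by apply: bmCM; [exact: bmC_cst|exact: bmC_char].
Qed.

Lemma bmC_repkernel s y : bmC (repkernel s y).
Proof.
apply: bmCM; first exact: bmC_cst.
apply: bmCM; last by apply: bmCM; exact: bmC_dirichlet.
apply: (@eq_bmC _ _ _ (fun x => character (dyv s 8) y * character (- dyv s 8) x)).
  by move=> x; rewrite characterDr characterN.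
by apply: bmCM; [exact: bmC_cst|exact: bmC_char].
Qed.

Lemma normc_nat n : normc (n%:R : R[i]) = n%:R.
Proof.
have -> : (n%:R : R[i]) = (n%:R)%:C by rewrite rmorph_nat.
by rewrite normc_real normr_nat.
Qed.

Lemma normc_repkernel s y x : normc (repkernel s y x) = (vol s)%:R^-1 *
  (normc (dirichlet (dy s 6) (y - x)) * normc (dirichlet (dy s 1) (y - x))).
Proof.
by rewrite !Normc.normcM Normc.normcV normc_nat normc_character mul1r.
Qed.

Lemma normc_repkernel_le s y x : normc (repkernel s y x) <= (6 ^ d)%:R * (vol s)%:R.
Proof.
have v0 : (0 : R) < (vol s)%:R by rewrite ltr0n vol_gt0.
rewrite normc_repkernel ler_pdivrMl//.
have := normc_dirichlet_le (dy s 6) (y - x).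
have := normc_dirichlet_le (dy s 1) (y - x).
rewrite !prod_dy exp1n mul1n natrM => h1 h6.
by rewrite [leRHS]mulrC ler_pM ?normc_ge0.
Qed.

Lemma mean_repkernel s y : mean (fun x => normc (repkernel s y x)) <= (6 ^ d)%:R.
Proof.
have v0 : (0 : R) < (vol s)%:R by rewrite ltr0n vol_gt0.
set A := fun x => normc (dirichlet (dy s 6) (y - x)) ^+ 2.
set B := fun x => normc (dirichlet (dy s 1) (y - x)) ^+ 2.
have bA : bm A by apply: bmM; exact: bm_normc (bmC_dirichlet _ _).
have bB : bm B by apply: bmM; exact: bm_normc (bmC_dirichlet _ _).
have le x : normc (repkernel s y x) <= ((vol s)%:R^-1 / 2) * (A x + B x).
  rewrite normc_repkernel -mulrA ler_wpM2l ?invr_ge0 ?(ltW v0)// /A /B.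
  set a := normc _; set b := normc _.
  by have := sqr_ge0 (a - b); rewrite sqrrB; lra.
apply: le_trans (le_mean (bm_normc (bmC_repkernel s y)) _ le) _.
  by apply: bmZ; exact: bmD.
rewrite meanZ; last exact: bmD.
rewrite meanD//.
have hA := mean_dirichlet_sq (dy s 6) y; have hB := mean_dirichlet_sq (dy s 1) y.
rewrite -/A -/B !prod_dy exp1n mul1n natrM in hA hB.
rewrite -mulrA ler_pdivrMl//.
have : (1 : R) <= (6 ^ d)%:R by rewrite ler1n expn_gt0.
move: hA hB v0; set a := mean A; set b := mean B; set v := (vol s)%:R => hA hB v0 h1.
rewrite ler_pdivrMl// (le_trans (lerD hA hB))//.
have : v <= (6 ^ d)%:R * v by rewrite ler_peMl// ltW.
lra.
Qed.

Lemma mean_repkernel_pair s s' y y' :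
  mean (fun x => normc (repkernel s y x) * normc (repkernel s' y' x)) <=
  (6 ^ d)%:R ^+ 3 * (\prod_j minn (2 ^ s j) (2 ^ s' j))%:R.
Proof.
have v0 : (0 : R) < (vol s)%:R by rewrite ltr0n vol_gt0.
have v0' : (0 : R) < (vol s')%:R by rewrite ltr0n vol_gt0.
pose E c x : R := (normc (dirichlet (dy s c) (y - x)) *
                   normc (dirichlet (dy s' c) (y' - x))) ^+ 2.
have bE c : bm (E c).
  have b0 : bm (fun x => normc (dirichlet (dy s c) (y - x)) *
                   normc (dirichlet (dy s' c) (y' - x))).
    by apply: bmM; exact: bm_normc (bmC_dirichlet _ _).
  exact: bmM.
set m := (\prod_j minn _ _)%N.
have hE c : mean (E c) <= (c ^ d)%:R ^+ 3 * ((vol s)%:R * (vol s')%:R * m%:R).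
  apply: le_trans (mean_dirichlet_pair _ _ _ _) _.
  rewrite !prod_dy (eq_bigr (fun j => c * minn (2 ^ s j) (2 ^ s' j)))%N; last first.
    by move=> j _; rewrite /dy minnMr.
  rewrite big_split/= prod_nat_const card_ord -/m !natrM.
  by set a := (c ^ d)%:R; rewrite le_eqVlt; apply/orP; left; apply/eqP; ring.
have le x : normc (repkernel s y x) * normc (repkernel s' y' x) <=
    ((vol s)%:R * (vol s')%:R)^-1 / 2 * (E 6%N x + E 1%N x).
  rewrite !normc_repkernel invfM mulrACA -[leRHS]mulrA.
  rewrite ler_wpM2l ?mulr_ge0 ?invr_ge0 ?(ltW v0) ?(ltW v0')//.
  rewrite /E mulrACA.
  set a := _ * normc (dirichlet (dy s' 6) _); set b := _ * normc (dirichlet (dy s' 1) _).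
  by have := sqr_ge0 (a - b); rewrite sqrrB; lra.
apply: le_trans (le_mean _ _ le) _.
- by apply: bmM; exact: bm_normc (bmC_repkernel _ _).
- by apply: bmZ; exact: bmD.
rewrite meanZ; last exact: bmD.
rewrite meanD// -mulrA ler_pdivrMl ?mulr_gt0//.
have h6 := hE 6%N; have := hE 1%N; rewrite exp1n expr1n mul1r => h1.
rewrite ler_pdivrMl// (le_trans (lerD h6 h1))//.
set V := (vol s)%:R * _ in h1 h6 *.
have V0 : 0 <= V * m%:R by rewrite mulr_ge0// ltW ?mulr_gt0.
have c1 : (1 : R) <= (6 ^ d)%:R ^+ 3.
  by rewrite -natrX ler1n !expn_gt0.
have : V * m%:R <= (6 ^ d)%:R ^+ 3 * (V * m%:R) by rewrite ler_peMl.
rewrite [V * (_ * _)]mulrCA.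
lra.
Qed.

(** The coefficient of [repkernel] at [- k] counts the representations of [k]. *)
Lemma repkernel_coef s y k :
  integralC (fun x => character k x * repkernel s y x) =
  (vol s)%:R^-1 *
  (\sum_(b <- box (dy s 1)) ((k - dyv s 8 - b)%R \in box (dy s 6)))%:R *
  character k y.
Proof.
pose F a b x : R[i] := (vol s)%:R^-1 * (character (dyv s 8 + a + b) y *
   character (k - (dyv s 8 + a + b)) x).
have bF a b : bmC (F a b).
  by apply: bmCM; [exact: bmC_cst|apply: bmCM; [exact: bmC_cst|exact: bmC_char]].
have FE x : character k x * repkernel s y x =
    \sum_(b <- box (dy s 1)) \sum_(a <- box (dy s 6)) F a b x.
  have -> : repkernel s y x = (vol s)%:R^-1 * \sum_(b <- box (dy s 1))
      \sum_(a <- box (dy s 6)) character (dyv s 8 + a + b) (y - x).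
    rewrite /repkernel; congr (_ * _).
    rewrite exchange_big/= /dirichlet big_distrl/= big_distrr/=.
    apply: eq_bigr => a _; rewrite !big_distrr/=; apply: eq_bigr => b _.
    by rewrite !characterD !mulrA.
  rewrite mulrCA !big_distrr/=; apply: eq_bigr => b _.
  rewrite !big_distrr/=; apply: eq_bigr => a _; rewrite /F; congr (_ * _).
  by rewrite characterDr characterN mulrCA -characterD.
rewrite (eq_integralC FE) integralC_sum; last first.
  by move=> b _; apply: bmC_sum => a _.
rewrite natr_sum mulr_sumr mulr_suml; apply: eq_bigr => b _.
rewrite integralC_sum//.
transitivity (\sum_(a <- box (dy s 6)) (vol s)%:R^-1 *
    (character k y * (a == k - dyv s 8 - b)%:R)).
  apply: eq_bigr => a _; rewrite /F integralCZ; last first.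
    by apply: bmCM; [exact: bmC_cst|exact: bmC_char].
  rewrite integralCZ; last exact: bmC_char.
  rewrite integralC_char; congr (_ * _).
  have -> : (a == k - dyv s 8 - b) = (k - (dyv s 8 + a + b) == 0).
    by rewrite !opprD !addrA addrAC subr_eq0 eq_sym.
  by case: eqP => [/eqP|]; rewrite ?mulr0//; rewrite subr_eq0 => /eqP <-.
rewrite -mulr_sumr -mulr_sumr mulrA mulrAC; congr (_ * _ * _).
rewrite -natr_sum -count_uniq_mem ?box_uniq// -sum1_count.
by rewrite [in RHS]big_mkcond.
Qed.

Lemma repkernel_reproduce s y f : has_spec (dyadic_box s 9 14) f ->
  integralC (fun x => f x * repkernel s y x) = f y.
Proof.
move=> [l Sl /funext ->].
pose F (a : R[i] * 'rV[int]_d) x := a.1 * (character a.2 x * repkernel s y x).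
have bF a : bmC (F a).
  apply: bmCM; first exact: bmC_cst.
  by apply: bmCM; [exact: bmC_char|exact: bmC_repkernel].
rewrite (@eq_integralC _ _ _ (fun x => \sum_(a <- l) F a x)); last first.
  move=> x; rewrite /trig big_distrl/=; apply: eq_bigr => a _.
  by rewrite /F mulrA.
rewrite integralC_sum// /trig big_seq [RHS]big_seq; apply: eq_bigr => a al.
rewrite /F integralCZ; last by apply: bmCM; [exact: bmC_char|exact: bmC_repkernel].
rewrite repkernel_coef; congr (_ * _).
rewrite (_ : (\sum_(b <- _) _)%N = vol s).
  by rewrite mulVf ?mul1r// pnatr_eq0 -lt0n vol_gt0.
have sz : size (box (dy s 1)) = vol s by rewrite size_box prod_dy exp1n mul1n.
rewrite -[RHS]sz -sum1_size.
rewrite big_seq [RHS]big_seq; apply: eq_bigr => b /mem_boxP bb.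
have Sa := Sl _ al.
suff -> : a.2 - dyv s 8 - b \in box (dy s 6) by [].
apply/mem_boxP => j; rewrite !mxE.
have arith (u t : int) (v : nat) : (9 * v)%N%:Z <= u < (14 * v)%N%:Z ->
    0 <= t < (1 * v)%N%:Z -> 0 <= u - (8 * v)%N%:Z - t < (6 * v)%N%:Z by lia.
exact: arith (Sa j) (bb j).
Qed.

Lemma repkernel_orthogonal S s y f : has_spec S f ->
  (forall k, S k -> ~ dyadic_box s 8 16 k) ->
  integralC (fun x => f x * repkernel s y x) = 0.
Proof.
move=> [l Sl /funext ->] nS.
pose F (a : R[i] * 'rV[int]_d) x := a.1 * (character a.2 x * repkernel s y x).
have bF a : bmC (F a).
  apply: bmCM; first exact: bmC_cst.
  by apply: bmCM; [exact: bmC_char|exact: bmC_repkernel].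
rewrite (@eq_integralC _ _ _ (fun x => \sum_(a <- l) F a x)); last first.
  move=> x; rewrite /trig big_distrl/=; apply: eq_bigr => a _.
  by rewrite /F mulrA.
rewrite integralC_sum// big_seq big1// => a al.
rewrite /F integralCZ; last by apply: bmCM; [exact: bmC_char|exact: bmC_repkernel].
rewrite repkernel_coef big_seq big1 ?mulr0 ?mul0r ?mulr0// => b /mem_boxP bb.
apply/eqP; rewrite eqb0; apply/negP => /mem_boxP ab.
apply: (nS a.2 (Sl _ al)) => j.
have arith (u t : int) (v : nat) : 0 <= u - (8 * v)%N%:Z - t < (6 * v)%N%:Z ->
    0 <= t < (1 * v)%N%:Z -> (8 * v)%N%:Z <= u < (16 * v)%N%:Z by lia.
by have := ab j; rewrite !mxE => /arith; apply; exact: bb j.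
Qed.

End Kernel.

(** * Peaked polynomials vanishing on the net *)

Section Vanishing.
Context {R : realType} {d : nat}.
Implicit Types (s : 'I_d -> nat) (k : 'rV[int]_d) (x y : 'rV[R]_d).

(** A trigonometric polynomial that vanishes on [zeros_w s]. *)
Definition zfactor s x : R[i] := \prod_j (expi ((dy s 2 j)%:R * x 0 j) - 1).

Lemma zfactor_eq0 s x : zeros_w s x -> zfactor s x = 0.
Proof.
rewrite /zeros_w /= /w => /eqP/prodf_eq0[j _ /eqP sj].
apply/eqP/prodf_eq0; exists j => //; rewrite subr_eq0; apply/eqP.
have -> : (dy s 2 j)%:R * x 0 j = 2 ^+ s j * x 0 j + 2 ^+ s j * x 0 j.
  by rewrite /dy natrM natrX -mulr2n -mulrnAl mulr_natl.
rewrite expiD /expi sj.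
have := cos2Dsin2 (2 ^+ s j * x 0 j); rewrite sj expr0n addr0 => c2.
by apply: complex_ext => /=; rewrite ?mulr0 ?mul0r ?subr0 ?addr0// -expr2 c2.
Qed.

(** The frequency of the term of [zfactor] indexed by [J]. *)
Definition zfactor_freq s (J : {set 'I_d}) : 'rV[int]_d :=
  \row_j (if j \in J then (dy s 2 j)%:Z else 0).

(** The coefficient of the term of [zfactor] indexed by [J]. *)
Definition zfactor_sign (J : {set 'I_d}) : R[i] := \prod_j (if j \in J then 1 else -1).

Lemma zfactorE s x :
  zfactor s x = \sum_(J : {set 'I_d}) zfactor_sign J * character (zfactor_freq s J) x.
Proof.
rewrite /zfactor bigA_distr; apply: eq_bigr => J _.
rewrite character_expi /zfactor_sign.
rewrite (big_morph (@expi R) (@expiD R) (@expi0 R)) -big_split/=.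
apply: eq_bigr => j _; rewrite !mxE; case: ifP => _.
  by rewrite mul1r -pmulrn.
by rewrite mul0r expi0 mulr1.
Qed.

(** More frequencies than points outside [zeros_w s] give a nonzero polynomial
    vanishing at these points; its product with [zfactor] is not zero, since the
    frequencies of the two factors add without collision. *)
Lemma vanishing_poly s m l (xi : 'I_m -> 'rV[R]_d) : (l < norm1 s)%N ->
  (range xi `\` zeros_w s #<= `I_(2 ^ l))%card ->
  exists T : 'rV[R]_d -> R[i], [/\ has_spec (dyadic_box s 0 3) T,
    forall j, T (xi j) = 0 & exists y, T y <> 0].
Proof.
move=> ls hA; set A := _ `\` _ in hA.
have finA : finite_set A.
  by apply: finite_setD; exact: finite_image.
pose pts : seq 'rV[R]_d := fset_set A.
have ptsA x : A x -> x \in pts by rewrite /pts in_fset_set// inE.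
have szp : (size pts <= 2 ^ l)%N by exact: geq_card_fset_set.
pose bx := box (dy s 1).
have szb : size bx = (2 ^ norm1 s)%N by rewrite size_box prod_dy exp1n mul1n volE.
have lt : (size pts < size bx)%N.
  by rewrite szb (leq_ltn_trans szp)// ltn_exp2l.
(* The coefficients form a row vector of the kernel of the evaluation matrix. *)
pose M : 'M[R[i]]_(size bx, size pts) :=
  \matrix_(i, j) character (nth 0 bx i) (nth 0 pts j).
have kerM : kermx M != 0.
  rewrite kermx_eq0 /row_free neq_ltn.
  by rewrite (leq_ltn_trans (rank_leq_col M)).
pose v := nz_row (kermx M).
have vM : v *m M = 0 by apply/sub_kermxP; exact: nz_row_sub.
have /rV0Pn[i0 vi0] : v != 0 by rewrite nz_row_eq0.
pose t x := \sum_i v 0 i * character (nth 0 bx i) x.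
pose T x := t x * zfactor s x.
have TE x : T x = \sum_(i < size bx) \sum_(J : {set 'I_d})
    (v 0 i * zfactor_sign J) * character (nth 0 bx i + zfactor_freq s J) x.
  rewrite /T /t zfactorE big_distrl/=; apply: eq_bigr => i _.
  rewrite big_distrr/=; apply: eq_bigr => J _.
  by rewrite characterD mulrACA.
have bxP (i : 'I_(size bx)) j : 0 <= (nth 0 bx i) 0 j < (dy s 1 j)%:Z.
  by apply/mem_boxP; exact: mem_nth.
exists T; split.
- apply: eq_has_spec TE _; apply: has_spec_sum => i _.
  apply: (has_spec_sum (I := {set 'I_d})) => J _; apply: has_specZ; apply: has_spec_char => j.
  have arith (a b : int) (p : nat) : 0 <= a < (1 * p)%N%:Z ->
    b = 0 \/ b = (2 * p)%N%:Z -> (0 * p)%N%:Z <= a + b < (3 * p)%N%:Z by lia.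
  rewrite !mxE; apply: arith; first exact: bxP.
  by case: ifP => _; [right|left].
- move=> j; have [wz|wz] := pselect (zeros_w s (xi j)).
    by rewrite /T zfactor_eq0// mulr0.
  have xp : xi j \in pts by apply: ptsA; split => //; exists j.
  rewrite /T [X in X * _](_ : _ = 0) ?mul0r//.
  have ip : (index (xi j) pts < size pts)%N by rewrite index_mem.
  have := congr1 (fun B : 'rV_ _ => B 0 (Ordinal ip)) vM; rewrite !mxE => <-.
  by apply: eq_bigr => i _; rewrite mxE /= nth_index.
- apply: contrapT => T0; have {}T0 y : T y = 0.
    by apply: contrapT => Ty; apply: T0; exists y.
  have : fourier T (nth 0 bx i0) = 0.
    rewrite /fourier (@eq_integralC _ _ _ (fun=> 0)); last first.
      by move=> x; rewrite T0 mul0r.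
    by rewrite integralCE /= !mean_cst.
  have bF (i : 'I_(size bx)) (J : {set 'I_d}) :
    bmC (fun x => (v 0 i * zfactor_sign J) *
      character (nth 0 bx i + zfactor_freq s J) x).
    by apply: bmCM; [exact: bmC_cst|exact: bmC_char].
  have /funext -> := TE.
  (* The coefficient of [T] at the frequency number [i0] comes from one term. *)
  have key (i : 'I_(size bx)) (J : {set 'I_d}) :
      nth 0 bx i + zfactor_freq s J = nth 0 bx i0 -> i = i0 /\ J = finset.set0.
    move=> E; have J0 : J = finset.set0.
      apply/setP => j; rewrite inE; apply/negP => jJ.
      have := congr1 (fun B : 'rV_ _ => B 0 j) E; rewrite !mxE jJ.
      have arith (a b : int) (p : nat) : 0 <= a < (1 * p)%N%:Z ->
        0 <= b < (1 * p)%N%:Z -> a + (2 * p)%N%:Z <> b by lia.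
      by apply: arith; exact: bxP.
    split=> //; apply/val_inj/eqP.
    rewrite -(nth_uniq 0 (ltn_ord i) (ltn_ord i0) (box_uniq _)); apply/eqP.
    rewrite -E [X in _ = _ + X](_ : _ = 0) ?addr0//.
    by apply/rowP => j; rewrite !mxE J0 inE.
  have cE (i : 'I_(size bx)) (J : {set 'I_d}) : fourier (fun x => (v 0 i * zfactor_sign J) *
      character (nth 0 bx i + zfactor_freq s J) x) (nth 0 bx i0) =
      (v 0 i * zfactor_sign J) * ((i == i0) && (J == finset.set0))%:R.
    rewrite fourierZ; last exact: bmC_char.
    rewrite fourier_character; congr (_ * (nat_of_bool _)%:R).
    apply/eqP/andP => [/key[-> ->]//|[/eqP -> /eqP ->]].
    rewrite [X in _ + X](_ : _ = 0) ?addr0//.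
    by apply/rowP => j; rewrite !mxE inE.
  rewrite fourier_sum; last by move=> i; apply: bmC_sum.
  rewrite (bigD1 i0)//= big1 ?addr0; last first.
    move=> i /negbTE ii0; rewrite fourier_sum// big1// => J _.
    by rewrite cE ii0 mulr0.
  rewrite fourier_sum// (bigD1 finset.set0)//= big1 ?addr0; last first.
    by move=> J /negbTE J0; rewrite cE J0 andbF mulr0.
  rewrite cE !eqxx mulr1 => /eqP; rewrite mulf_eq0 (negbTE vi0)/= /zfactor_sign.
  rewrite (eq_bigr (fun=> -1)); last by move=> j _; rewrite inE.
  by rewrite prodr_const signr_eq0.
Qed.

(** At [y], [|T|] takes at least half of its supremum. *)
Lemma peak_normalize (S : set 'rV[int]_d) (T : 'rV[R]_d -> R[i]) :
  has_spec S T -> (exists y, T y <> 0) ->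
  exists2 y, 0 < normc (T y) & forall x, normc (T x) <= 2 * normc (T y).
Proof.
move=> sT [y0 Ty0].
have [M TM] := has_spec_bounded sT.
pose E : set R := [set normc (T x) | x in setT].
have n0 : 0 < normc (T y0).
  rewrite lt0r normc_ge0 andbT; apply/eqP => /Normc.eq0_normc; exact: Ty0.
have hsE : has_sup E.
  by split; [exists (normc (T y0)), y0|exists M => _ [x _ <-]].
have ub x : normc (T x) <= sup E by apply: ub_le_sup; [case: hsE|exists x].
have s0 : 0 < sup E by apply: lt_le_trans n0 (ub y0).
have [_ [y _ <-] hy] := @sup_adherent _ E (sup E / 2) (divr_gt0 s0 (ltr0n _ 2)) hsE.
have {}hy : sup E / 2 < normc (T y).
  by apply: le_lt_trans hy; rewrite {2}[sup E]splitr addrK.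
exists y; first by apply: lt_trans hy; rewrite divr_gt0.
by move=> x; apply: le_trans (ub x) _; rewrite mulrC -ler_pdivrMr// ltW.
Qed.

(** The peak of level [s]. *)
Lemma peak_poly s m l (xi : 'I_m -> 'rV[R]_d) : (l < norm1 s)%N ->
  (range xi `\` zeros_w s #<= `I_(2 ^ l))%card ->
  exists (g : 'rV[R]_d -> R[i]) (y : 'rV[R]_d),
    [/\ has_spec (dyadic_box s 9 14) g, forall j, g (xi j) = 0,
        g y = ((vol s)%:R ^+ 2 : R)%:C &
        forall x, normc (g x) <= 2 * normc (dirichlet (dy s 1) (y - x)) ^+ 2].
Proof.
move=> ls hA; have [T [sT Txi Tn0]] := vanishing_poly ls hA.
have [y Ty0 Tle] := peak_normalize sT Tn0.
have Tyn : T y != 0 by apply/eqP => Ty; move: Ty0; rewrite Ty Normc.normc0 ltxx.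
pose D x := dirichlet (dy s 1) (x - y).
exists (fun x => (T y)^-1 * (character (dyv s 9) (x - y) * (T x * (D x * D x)))), y.
have sD : has_spec (dyadic_box s 0 1) D.
  apply: (@eq_has_spec _ _ _ _ (fun x => \sum_(k <- box (dy s 1))
     character k (- y) * character k x)).
    by move=> x; apply: eq_bigr => k _; rewrite characterDr mulrC.
  apply: has_spec_sum => k /mem_boxP kb; apply: has_specZ; apply: has_spec_char.
  by move=> j; have := kb j; rewrite /dy mul0n.
have sC : has_spec [set dyv s 9] (fun x => character (dyv s 9) (x - y)).
  apply: (@eq_has_spec _ _ _ _ (fun x => character (dyv s 9) (- y) * character (dyv s 9) x)).
    by move=> x; rewrite characterDr mulrC.
  by apply: has_specZ; apply: has_spec_char.
have add b b' (k1 k2 : 'rV[int]_d) :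
    dyadic_box s 0 b k1 -> dyadic_box s 0 b' k2 -> dyadic_box s 0 (b + b') (k1 + k2).
  move=> h1 h2 j.
  have arith (u t : int) (q p p' : nat) : (0 * q)%N%:Z <= u < p%:Z ->
    (0 * q)%N%:Z <= t < p'%:Z -> (0 * q)%N%:Z <= u + t < (p + p')%N%:Z by lia.
  by rewrite mxE /dy mulnDl; apply: arith; [exact: h1|exact: h2].
split.
- apply: has_specZ; apply: (has_specM _ sC (S2 := dyadic_box s 0 (3 + (1 + 1)))); last first.
    exact: (has_specM (add _ _) sT (has_specM (add _ _) sD sD)).
  move=> k1 k2 -> h2 j; rewrite !mxE /dy.
  have arith (u : int) (p : nat) : (0 * p)%N%:Z <= u < (5 * p)%N%:Z ->
    (9 * p)%N%:Z <= (9 * p)%N%:Z + u < (14 * p)%N%:Z by lia.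
  exact: arith (h2 j).
- by move=> j; rewrite Txi mul0r !mulr0.
- have -> : D y = (vol s)%:R by rewrite /D subrr dirichlet0 prod_dy exp1n mul1n.
  rewrite subrr character0r mul1r mulKf// -expr2.
  by rewrite rmorphXn/= rmorph_nat.
- move=> x; rewrite !Normc.normcM Normc.normcV normc_character mul1r.
  have -> : normc (D x) = normc (dirichlet (dy s 1) (y - x)).
    by rewrite /D -normc_dirichletN opprB.
  rewrite mulrA -expr2 ler_wpM2r ?sqr_ge0//.
  by rewrite ler_pdivrMl// mulrC.
Qed.

End Vanishing.

(** * Norms, dyadic shells and the size of a block *)

Section Norm.
Context {R : realType} {d : nat}.

Lemma EFin_mean (f : 'rV[R]_d -> R) : bm f ->
  (\int[torus_prob d]_t (f (row_of_tuple t))%:E)%E = (mean f)%:E.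
Proof.
move=> bf; rewrite /mean /Rintegral fineK//.
exact: integrable_fin_num (bm_integrable bf).
Qed.

Lemma Lnorm_mean (p : R) (f : 'rV[R]_d -> R) : 0 < p -> (forall x, 0 <= f x) ->
  bm f -> Lnorm (torus_prob d) p%:E (EFin \o (fun t => f (row_of_tuple t))) =
  ((mean (fun x => f x `^ p)) `^ p^-1)%:E.
Proof.
move=> p0 f0 bf; rewrite unlock.
rewrite (eq_integral (fun t => (f (row_of_tuple t) `^ p)%:E)); last first.
  by move=> t _; rewrite /= ger0_norm.
rewrite (@EFin_mean (fun x => f x `^ p)) ?poweR_EFin//.
by apply: bm_powR => //; exact: ltW.
Qed.

Lemma norm_pE (p : R) (f : 'rV[R]_d -> R[i]) : 0 < p -> bmC f ->
  norm_p p f = ((mean (fun x => normc (f x) `^ p)) `^ p^-1)%:E.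
Proof.
move=> p0 bf; apply: (@Lnorm_mean p (fun x => normc (f x))) => //.
  by move=> x; exact: normc_ge0.
exact: bm_normc.
Qed.

Lemma mean_hoelder (p u : R) (f g : 'rV[R]_d -> R) : 0 < p -> 0 < u ->
  p^-1 + u^-1 = 1 -> (forall x, 0 <= f x) -> (forall x, 0 <= g x) ->
  bm f -> bm g ->
  mean (fun x => f x * g x) <=
  (mean (fun x => f x `^ p)) `^ p^-1 * (mean (fun x => g x `^ u)) `^ u^-1.
Proof.
move=> p0 u0 pu f0 g0 bf bg.
have := hoelder (torus_prob d) bf.1 bg.1 p0 u0 pu.
rewrite (Lnorm_mean p0 f0 bf) (Lnorm_mean u0 g0 bg) Lnorm1.
under eq_integral do rewrite /= ger0_norm ?mulr_ge0//.
by rewrite (EFin_mean (bmM bf bg)) -EFinM lee_fin.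
Qed.

End Norm.

Section Rho.
Context {d : nat}.
Implicit Types (s : 'I_d -> nat) (k : 'rV[int]_d).

(** The shells [rho s] are pairwise disjoint. *)
Lemma rho_inj s s' k : rho s k -> rho s' k -> s = s'.
Proof.
have aux (a b m : nat) : (m < 2 ^ a)%N -> (2 ^ b %/ 2 <= m)%N -> (b <= a)%N.
  move=> ma bm; rewrite leqNgt; apply/negP => ab.
  have : (2 ^ a <= 2 ^ b %/ 2)%N.
    case: b ab {bm} => // b ab; rewrite expnS mulKn// leq_exp2l//.
  by move=> /leq_trans/(_ bm); rewrite leqNgt ma.
move=> h h'; apply/funext => j.
have /andP[a1 a2] := h j; have /andP[b1 b2] := h' j.
by apply/eqP; rewrite eqn_leq (aux _ _ _ b2 a1) (aux _ _ _ a2 b1).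
Qed.

Lemma dyadic_box_rho s : dyadic_box s 8 16 `<=` rho (fun j => s j + 4)%N.
Proof.
move=> k kb j; have := kb j; rewrite /dy expnD.
set v := (2 ^ s j)%N => h.
have -> : (v * 2 ^ 4 %/ 2 = 8 * v)%N by rewrite (_ : 2 ^ 4 = 8 * 2)%N// mulnA mulnK// mulnC.
have arith (u : int) (w : nat) : (8 * w)%N%:Z <= u < (16 * w)%N%:Z ->
  (8 * w <= absz u < w * 16)%N by lia.
exact: arith h.
Qed.

Lemma sub_dyadic_box s (a b a' b' : nat) : (a' <= a)%N -> (b <= b')%N ->
  dyadic_box s a b `<=` dyadic_box s a' b'.
Proof.
move=> aa bb k kb j; have /andP[h1 h2] := kb j; apply/andP; split.
  by apply: le_trans h1; rewrite lez_nat leq_mul2r aa orbT.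
by apply: lt_le_trans h2 _; rewrite lez_nat leq_mul2r bb orbT.
Qed.

End Rho.

Section Block.
Context {R : realType} {d : nat}.

(** The [L_q]-norm of a multiple of a peak. *)
Lemma peak_norm_le (s : 'I_d -> nat) (g : 'rV[R]_d -> R[i]) (y : 'rV[R]_d)
    (q lam : R) :
  1 <= q -> 0 <= lam -> bmC g ->
  (forall x, normc (g x) <= 2 * normc (dirichlet (dy s 1) (y - x)) ^+ 2) ->
  (mean (fun x => normc (lam%:C * g x) `^ q)) `^ q^-1 <=
  2 * lam * (vol s)%:R `^ (2 - q^-1).
Proof.
move=> q1 l0 bg gle; set V : R := (vol s)%:R.
have q0 : 0 < q by lra.
have V0 : 0 < V by rewrite ltr0n vol_gt0.
pose E x := normc (dirichlet (dy s 1) (y - x)) ^+ 2.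
have E0 x : 0 <= E x by exact: sqr_ge0.
have bE : bm E by apply: bmM; exact: bm_normc (bmC_dirichlet _ _).
have EV x : E x <= V `^ 2.
  have := normc_dirichlet_le (dy s 1) (y - x).
  rewrite prod_dy exp1n mul1n -/V => h.
  by rewrite powR_mulrn ?(ltW V0)// /E lerXn2r ?nnegrE ?normc_ge0 ?(ltW V0).
have blg : bmC (fun x => lam%:C * g x) by apply: bmCM => //; exact: bmC_cst.
have pw x : normc (lam%:C * g x) `^ q <= (2 * lam) `^ q * V `^ (2 * (q - 1)) * E x.
  apply: (@le_trans _ _ ((2 * lam * E x) `^ q)).
    have lE0 : 0 <= 2 * lam * E x := mulr_ge0 (mulr_ge0 (ler0n _ 2) l0) (E0 x).
    rewrite ge0_ler_powR ?nnegrE ?(ltW q0) ?normc_ge0//.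
    rewrite Normc.normcM normc_real ger0_norm// [2 * lam]mulrC -mulrA.
    by rewrite ler_wpM2l.
  have l2 : 0 <= 2 * lam by rewrite mulr_ge0.
  rewrite (powRM _ l2 (E0 x)) -mulrA ler_wpM2l ?powR_ge0//.
  have [->|En] := eqVneq (E x) 0; first by rewrite powR0 ?gt_eqF// mulr0.
  have Ep : 0 < E x by rewrite lt0r En E0.
  rewrite (powR_pred _ Ep) ler_wpM2r// powRrM ge0_ler_powR ?nnegrE ?subr_ge0 ?powR_ge0//.
have -> : 2 * lam * V `^ (2 - q^-1) =
    ((2 * lam) `^ q * V `^ (2 * (q - 1)) * V) `^ q^-1.
  rewrite -[X in _ = X `^ _]mulrA powRM ?mulr_ge0 ?powR_ge0 ?(ltW V0)//.
  rewrite -powRrM mulfV ?gt_eqF// powRr1 ?mulr_ge0//; congr (_ * _).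
  rewrite -{3}[V]powRr1 ?(ltW V0)// -powRD; last by rewrite (gt_eqF V0) implybT.
  by rewrite -powRrM; congr (_ `^ _); field; rewrite gt_eqF.
rewrite ge0_ler_powR ?nnegrE ?invr_ge0 ?(ltW q0)//.
- by apply: mean_ge0 => x; exact: powR_ge0.
- by rewrite !mulr_ge0 ?powR_ge0 ?(ltW V0).
apply: le_trans (le_mean _ _ pw) _.
- apply: bm_powR; [exact: ltW|by move=> x; exact: normc_ge0|exact: bm_normc].
- exact: bmZ.
rewrite meanZ// ler_wpM2l ?mulr_ge0 ?powR_ge0//.
have := mean_dirichlet_sq (dy s 1) y.
by rewrite prod_dy exp1n mul1n.
Qed.

End Block.

(** * The sum of the blocks *)

Section Blocks.
Context {R : realType} {d' n : nat}.
Local Notation d := d'.+1.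
Local Notation I := (level_index d' n).
Context (g : I -> 'rV[R]_d -> R[i]) (y : I -> 'rV[R]_d)
  (sg : forall phi, has_spec (dyadic_box (level phi) 9 14) (g phi)).

Let bg phi : bmC (g phi). Proof. exact: has_spec_bmC (sg phi). Qed.

Let F (lam : R) phi x := lam%:C * g phi x.

Let sF lam phi : has_spec (dyadic_box (level phi) 9 14) (F lam phi).
Proof. exact: has_specZ. Qed.

Let bF lam phi : bmC (F lam phi).
Proof. exact: has_spec_bmC (sF lam phi). Qed.

Let sub8 (phi : I) : dyadic_box (level phi) 9 14 `<=` dyadic_box (level phi) 8 16.
Proof. exact: sub_dyadic_box. Qed.

Lemma dyadic_box_level_disjoint (phi psi : I) (k : 'rV[int]_d) : phi != psi ->
  dyadic_box (level phi) 9 14 k -> ~ dyadic_box (level psi) 8 16 k.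
Proof.
move=> /eqP ne h1 h2; apply: ne; apply: level_inj; apply/funext => j.
have h3 := dyadic_box_rho (sub8 h1).
have /(congr1 (fun f => f j)) := rho_inj h3 (dyadic_box_rho h2).
by move/addIn.
Qed.

(** Each peak lies in a single shell, and different peaks lie in different shells. *)
Lemma delta_sum_blocks lam (s : 'I_d -> nat) :
  (exists2 phi, s = (fun j => level phi j + 4)%N &
    delta s (fun x => \sum_phi F lam phi x) = F lam phi) \/
  delta s (fun x => \sum_phi F lam phi x) = fun=> 0.
Proof.
have [[phi sE]|ns] := pselect (exists phi : I, s = (fun j => level phi j + 4)%N).
  left; exists phi => //; apply/funext => x.
  rewrite delta_sum; last exact: bF.
  rewrite (bigD1 phi)//= big1 ?addr0; last first.
    move=> psi np; apply: (delta_disjoint (S := dyadic_box (level psi) 9 14)) => // k k1.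
    rewrite sE => k2.
    have h3 := dyadic_box_rho (sub8 k1).
    move/eqP: np; apply; apply: level_inj; apply/funext => j.
    by have /(congr1 (fun f => f j)) := rho_inj h3 k2; move/addIn.
  apply: (delta_id (S := dyadic_box (level phi) 9 14)) => //.
  rewrite sE => k k1.
  exact: dyadic_box_rho (sub8 k1).
right; apply/funext => x; rewrite delta_sum; last exact: bF.
rewrite big1// => psi _.
apply: (delta_disjoint (S := dyadic_box (level psi) 9 14)) => // k k1 k2.
have h3 := dyadic_box_rho (sub8 k1).
by apply: ns; exists psi; exact: rho_inj k2 h3.
Qed.

Lemma norm1_shift (phi : I) : norm1 (fun j => level phi j + 4)%N = (n + 4 * d)%N.
Proof.
rewrite /norm1 big_split/= -/(norm1 _) norm1_level sum_nat_const card_ord.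
by rewrite mulnC.
Qed.

Lemma vol_level (phi : I) : (vol (level phi))%:R = 2 `^ n%:R :> R.
Proof. by rewrite volE norm1_level natrX powR_mulrn. Qed.

Context (gle : forall phi x,
  normc (g phi x) <= 2 * normc (dirichlet (dy (level phi) 1) (y phi - x)) ^+ 2).

Lemma normH_sum_blocks (r q : R) :
  let lam := 2^-1 * 2 `^ (- (n%:R * (2 - q^-1)) - r * (n + 4 * d)%N%:R) in
  1 <= q ->
  (normH r q (fun x => \sum_phi F lam phi x)%R <= 1)%E.
Proof.
move=> lam q1; apply: ge_ereal_sup => _ [s _ <-].
have q0 : 0 < q by lra.
have l0 : 0 <= lam by rewrite mulr_ge0 ?powR_ge0.
case: (delta_sum_blocks lam s) => [[phi sE ->]|->]; last first.
  rewrite norm_pE//; last exact: bmC_cst.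
  rewrite (@eq_mean _ _ _ (fun=> 0)); last first.
    by move=> x; rewrite Normc.normc0 powR0// gt_eqF.
  by rewrite mean_cst powR0 ?invr_eq0 ?gt_eqF// mul0e.
rewrite norm_pE// -EFinM lee_fin sE norm1_shift.
have := peak_norm_le q1 l0 (bg phi) (@gle phi).
rewrite vol_level -powRrM => h.
apply: le_trans (ler_wpM2r (powR_ge0 _ _) h) _.
rewrite /lam [2 * _]mulrA mulfV// mul1r -!powRD ?pnatr_eq0 ?implybT//.
by rewrite [X in _ `^ X](_ : _ = 0) ?powRr0//; ring.
Qed.

Let h phi := repkernel (level phi) (y phi).

Context (gy : forall phi, g phi (y phi) = ((vol (level phi))%:R ^+ 2 : R)%:C).

Lemma pairing_sum_blocks lam :
  integralC (fun x => (\sum_phi F lam phi x) * (\sum_phi h phi x)) =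
  (#|{: I}|%:R * (lam * (2 `^ n%:R) ^+ 2))%:C.
Proof.
have bh phi : bmC (h phi) by exact: bmC_repkernel.
rewrite (@eq_integralC _ _ _ (fun x => \sum_phi \sum_psi F lam psi x * h phi x)); last first.
  by move=> x; rewrite big_distrr/=; apply: eq_bigr => phi _; rewrite big_distrl.
rewrite integralC_sum; last first.
  by move=> phi _; apply: bmC_sum => psi _; exact: bmCM.
rewrite (eq_bigr (fun=> (lam * (2 `^ n%:R) ^+ 2)%:C)).
  by rewrite sumr_const mulr_natl rmorphMn.
move=> phi _; rewrite integralC_sum; last by move=> psi _; exact: bmCM.
rewrite (bigD1 phi)//= big1 ?addr0; last first.
  move=> psi np; apply: (repkernel_orthogonal _ (sF lam psi)) => k.
  exact: dyadic_box_level_disjoint.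
rewrite (repkernel_reproduce _ (sF lam phi)) /F gy vol_level.
by apply: complex_ext; rewrite /= !(mul0r, mulr0) ?subr0 ?addr0.
Qed.

Lemma pairing_le_norms lam (p u : R) : 0 < p -> 0 < u -> p^-1 + u^-1 = 1 ->
  #|{: I}|%:R * (lam * (2 `^ n%:R) ^+ 2) <=
  (mean (fun x => normc (\sum_phi F lam phi x) `^ p)) `^ p^-1 *
  (mean (fun x => (\sum_phi normc (h phi x)) `^ u)) `^ u^-1.
Proof.
move=> p0 u0 pu.
have bh phi : bmC (h phi) by exact: bmC_repkernel.
have bSF : bmC (fun x => \sum_phi F lam phi x) by exact: bmC_sum.
have bSh : bmC (fun x => \sum_phi h phi x) by exact: bmC_sum.
have bSn : bm (fun x => \sum_phi normc (h phi x)).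
  by apply: bm_sum => phi _; exact: bm_normc.
apply: le_trans (mean_hoelder p0 u0 pu _ _ (bm_normc bSF) bSn); last 2 first.
- by move=> x; exact: normc_ge0.
- by move=> x; apply: sumr_ge0 => phi _; exact: normc_ge0.
have -> : #|{: I}|%:R * (lam * (2 `^ n%:R) ^+ 2) =
    complex.Re (integralC (fun x => (\sum_phi F lam phi x) * (\sum_phi h phi x))).
  by rewrite pairing_sum_blocks.
rewrite integralCE /=; apply: le_mean; first exact: (bmCM bSF bSh).1.
  by apply: bmM => //; exact: bm_normc.
move=> x; apply: le_trans (Re_le_normc _) _; rewrite Normc.normcM.
by rewrite ler_wpM2l ?normc_ge0// le_normc_sum.
Qed.

Lemma mean_sum_repkernel (u : R) :
  let e := Num.min (u - 1) 1 / (2 * u) in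
  let K := (2 / (1 - 2 `^ (- (e / 2)))) ^+ d' in
  let C := (6 ^ d)%:R ^+ 3 in
  1 < u ->
  mean (fun x => (\sum_phi normc (h phi x)) `^ u) <=
  K `^ u * (C * 2 `^ n%:R) `^ (u - 1) * (C + 1) * K * #|{: I}|%:R.
Proof.
move=> e K C u1.
have e0 : 0 < e by rewrite divr_gt0 ?mulr_gt0 ?lt_min ?ltr01 ?subr_gt0 ?u1//; lra.
have c1 : (1 : R) <= (6 ^ d)%:R by rewrite ler1n expn_gt0.
have cC : (6 ^ d)%:R <= C.
  by rewrite -[leLHS]expr1 ler_weXn2l.
have C1 : 1 <= C by exact: le_trans cC.
have K0 : 0 <= K.
  rewrite exprn_ge0// divr_ge0// subr_ge0 powRN invf_le1 ?powR_gt0//.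
  have : (2 : R) `^ 0 <= 2 `^ (e / 2)
    by apply: ler_powR; [rewrite ler1n|apply: divr_ge0 => //; exact: ltW].
  by rewrite powRr0.
apply: (@mean_sum_powR _ _ _ _ (fun phi psi => level_dist phi psi)) => //.
- by move=> phi; exact: bm_normc (bmC_repkernel _ _).
- by move=> phi x; exact: normc_ge0.
- move=> phi x; apply: le_trans (normc_repkernel_le _ _ _) _.
  by rewrite vol_level ler_wpM2r ?powR_ge0.
- by move=> phi; exact: le_trans (mean_repkernel _ _) cC.
- move=> phi psi; apply: le_trans (mean_repkernel_pair _ _ _ _) _.
  rewrite -mulrA ler_wpM2l ?(le_trans ler01)// powR_mulrn//.
  exact: prod_min_level.
- by move=> phi psi; exact: level_dist_ge0.
- by move=> phi; exact: sum_level_dist.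
Qed.

End Blocks.

(** * The lower bound *)

(** The final comparison of exponents: here [N] is the number of levels, [X] the
    norm of the test function, and [u] the exponent conjugate to [p]. *)
Lemma exponent_bookkeeping (R : realType) (d' n N : nat) (r p q u B X : R) :
  let lam := 2^-1 * 2 `^ (- (n%:R * (2 - q^-1)) - r * (n + 4 * d'.+1)%N%:R) in
  0 < p -> 0 < u -> p^-1 + u^-1 = 1 -> 0 < B -> (0 < n)%N ->
  (n ^ d' <= d'.+1 ^ d' * N)%N ->
  N%:R * (lam * (2 `^ n%:R) ^+ 2) <=
    X * (B * (2 `^ n%:R) `^ (u - 1) * N%:R) `^ u^-1 ->
  B `^ (- u^-1) * 2^-1 * 2 `^ (- (4 * r * d'.+1%:R)) *
    (d'.+1 ^ d')%:R `^ (- p^-1) *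
    (2 `^ (- (n%:R * (r - (q^-1 - p^-1)))) * n%:R `^ ((d'.+1%:R - 1) / p)) <= X.
Proof.
move=> lam p0 u0 pu B0 n0 nN.
have u1 : u^-1 = 1 - p^-1 by lra.
have N0 : (0 < N)%N.
  by move: nN; case: N => //; rewrite muln0 leqn0 expn_eq0 -leqn0 leqNgt n0.
have NR0 : (0 : R) < N%:R by rewrite ltr0n.
have D0 : (0 : R) < (d'.+1 ^ d')%:R by rewrite ltr0n expn_gt0.
have S0 : (0 : R) < 2 `^ n%:R by rewrite powR_gt0.
set Z := (_ * _) `^ u^-1.
have ZE : Z = B `^ u^-1 * 2 `^ (n%:R / p) * N%:R `^ u^-1.
  rewrite /Z powRM ?mulr_ge0 ?powR_ge0 ?(ltW B0)// powRM ?powR_ge0 ?(ltW B0)//.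
  rewrite -!powRrM; congr (_ * _ `^ _ * _).
  congr (_ * _).
  by rewrite mulrBl divff ?gt_eqF// mul1r u1; ring.
have Z0 : 0 < Z by rewrite powR_gt0// !mulr_gt0 ?powR_gt0.
move=> H; rewrite -(ler_pM2r Z0); apply: le_trans H.
have nle : n%:R `^ ((d'.+1%:R - 1) / p) <= (d'.+1 ^ d')%:R `^ p^-1 * N%:R `^ p^-1 :> R.
  rewrite -powRM ?ler0n// powRrM -natr1 addrK powR_mulrn// -natrX.
  by rewrite ge0_ler_powR ?nnegrE ?invr_ge0 ?(ltW p0)// -natrM ler_nat.
have NE : N%:R = N%:R `^ p^-1 * N%:R `^ u^-1 :> R.
  by rewrite -powRD ?pu ?powRr1//; rewrite (gt_eqF NR0) implybT.
have two (a b : R) : 2 `^ a * 2 `^ b = 2 `^ (a + b).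
  by rewrite -powRD// pnatr_eq0 implybT.
have lE : lam * (2 `^ n%:R) ^+ 2 = 2^-1 * (2 `^ (- (4 * r * d'.+1%:R)) *
    2 `^ (- (n%:R * (r - (q^-1 - p^-1)))) * 2 `^ (n%:R / p)).
  rewrite /lam -mulrA expr2 !two; congr (_ * _ `^ _).
  by rewrite natrD natrM; ring.
have BE : B `^ (- u^-1) * B `^ u^-1 = 1.
  by rewrite -powRD ?addNr ?powRr0//; rewrite (gt_eqF B0) implybT.
have DE : (d'.+1 ^ d')%:R `^ (- p^-1) * (d'.+1 ^ d')%:R `^ p^-1 = 1 :> R.
  by rewrite -powRD ?addNr ?powRr0//; rewrite (gt_eqF D0) implybT.
rewrite lE ZE [X in _ <= X * _]NE.
move: nle BE DE.
set b1 := B `^ _; set b2 := B `^ _; set n1 := n%:R `^ _; set d1 := _ `^ (- p^-1).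
set d2 := _ `^ p^-1; set t1 := 2 `^ _; set t2 := 2 `^ _; set t3 := 2 `^ _.
set N1 := N%:R `^ _; set N2 := N%:R `^ _ => nle BE DE.
have -> : b1 * 2^-1 * t1 * d1 * (t2 * n1) * (b2 * t3 * N2) =
  (b1 * b2) * (2^-1 * t1 * t2 * t3 * N2 * d1) * n1 by ring.
have -> : N1 * N2 * (2^-1 * (t1 * t2 * t3)) =
  (d1 * d2) * (2^-1 * t1 * t2 * t3 * N2 * N1) by rewrite DE; ring.
rewrite BE mul1r.
have -> : d1 * d2 * (2^-1 * t1 * t2 * t3 * N2 * N1) =
  2^-1 * t1 * t2 * t3 * N2 * d1 * (d2 * N1) by ring.
by rewrite ler_wpM2l// !mulr_ge0 ?powR_ge0.
Qed.

Theorem theorem5p1 (R : realType) (d : nat) (r p q : R)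
    (d_gt0 : (0 < d)%N) (r_gt0 : 0 < r) (q_ge1 : 1 <= q) (ltqp : q < p) :
  let beta := q^-1 - p^-1 in
  exists2 c : R, 0 < c &
    forall (n m : nat) (xi : 'I_m -> 'rV[R]_d)
        (psi : 'I_m -> 'rV[R]_d -> R[i]),
      (0 < n)%N -> (0 < m)%N ->
      (forall j, torus (xi j)) -> is_net n n.-1 xi ->
      (forall j, Lp p (psi j)) ->
      ((c * (2 `^ (- (n%:R * (r - beta))) * n%:R `^ ((d%:R - 1) / p)))%:E <=
         recover_err xi psi (Hclass r q) p)%E.
Proof.
case: d d_gt0 => // d' _ beta.
have q0 : 0 < q by lra.
have p1 : 1 < p by lra.
have p0 : 0 < p by lra.
pose u : R := (1 - p^-1)^-1.
have pi1 : p^-1 < 1 by rewrite invf_lt1.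
have u0 : 0 < u by rewrite invr_gt0 subr_gt0.
have u1 : 1 < u.
  by rewrite -[ltLHS]invr1 ltf_pV2 ?posrE ?subr_gt0// ltrBlDr ltrDl invr_gt0.
have pu : p^-1 + u^-1 = 1 by rewrite /u invrK; lra.
pose e := Num.min (u - 1) 1 / (2 * u).
pose K := (2 / (1 - 2 `^ (- (e / 2)))) ^+ d'.
pose C : R := (6 ^ d'.+1)%:R ^+ 3.
pose B := `|K `^ u * C `^ (u - 1) * (C + 1) * K| + 1.
(* Adding 1 makes [B] positive at no cost. *)
have B0 : 0 < B by rewrite ltr_wpDl.
exists (B `^ (- u^-1) * 2^-1 * 2 `^ (- (4 * r * d'.+1%:R)) *
    (d'.+1 ^ d')%:R `^ (- p^-1)).
  by rewrite !mulr_gt0 ?powR_gt0 ?invr_gt0// ltr0n expn_gt0.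
move=> n m xi psi n0 _ _ net _.
pose I := level_index d' n.
have blocks (phi : I) : exists gy : ('rV[R]_d'.+1 -> R[i]) * 'rV[R]_d'.+1,
    [/\ has_spec (dyadic_box (level phi) 9 14) gy.1, forall j, gy.1 (xi j) = 0,
        gy.1 gy.2 = ((vol (level phi))%:R ^+ 2 : R)%:C &
        forall x, normc (gy.1 x) <=
          2 * normc (dirichlet (dy (level phi) 1) (gy.2 - x)) ^+ 2].
  have [||g [y H]] := @peak_poly R d'.+1 (level phi) m n.-1 xi.
  - by rewrite norm1_level prednK.
  - exact: net (norm1_level phi).
  - by exists (g, y).
have [gy gyP] := choice blocks.
pose g phi := (gy phi).1; pose y phi := (gy phi).2.
have sg phi : has_spec (dyadic_box (level phi) 9 14) (g phi) by have [] := gyP phi.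
have gxi phi j : g phi (xi j) = 0 by have [_ h _ _] := gyP phi; exact: h.
have gyy phi : g phi (y phi) = ((vol (level phi))%:R ^+ 2 : R)%:C.
  by have [] := gyP phi.
have gle phi x : normc (g phi x) <=
    2 * normc (dirichlet (dy (level phi) 1) (y phi - x)) ^+ 2.
  by have [_ _ _ h] := gyP phi; exact: h.
pose lam := 2^-1 * 2 `^ (- (n%:R * (2 - q^-1)) - r * (n + 4 * d'.+1)%N%:R).
pose f x := \sum_(phi : I) lam%:C * g phi x.
have sf : has_spec setT f.
  apply: (has_spec_sum (I := I)) => phi _; apply: has_specZ.
  exact: sub_has_spec (sg phi).
have bf : bmC f by exact: has_spec_bmC sf.
have f0 j : f (xi j) = 0 by apply: big1 => phi _; rewrite gxi mulr0.
pose X := (mean (fun x => normc (f x) `^ p)) `^ p^-1.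
apply: (@le_trans _ _ X%:E); last first.
  apply: ereal_sup_ubound; exists f; last first.
    rewrite -(norm_pE p0 bf); congr norm_p; apply/funext => x.
    by rewrite /recover big1 ?subr0// => j _; rewrite f0 mul0r.
  split; last exact: has_spec_continuous sf.
  split; last exact: (normH_sum_blocks sg gle r q_ge1).
  split; first exact: has_spec_periodic sf.
  - by split; [exact: bf.1.1|exact: bf.2.1].
  - by rewrite norm_pE// ltry.
rewrite lee_fin /beta.
apply: (@exponent_bookkeeping _ d' n #|{: I}| r p q u B X) => //.
  exact: card_level_index.
apply: le_trans (pairing_le_norms sg gyy lam p0 u0 pu) _.
have ui0 : 0 <= u^-1 by rewrite invr_ge0 ltW.
rewrite ler_wpM2l ?powR_ge0// (ge0_ler_powR ui0) ?nnegrE//.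
- by apply: mean_ge0 => x; exact: powR_ge0.
- by rewrite !mulr_ge0 ?powR_ge0 ?(ltW B0).
apply: le_trans (mean_sum_repkernel _ u1) _; rewrite -/e -/K -/C.
rewrite powRM ?powR_ge0//; last by rewrite exprn_ge0.
rewrite ler_wpM2r//.
have -> : K `^ u * (C `^ (u - 1) * (2 `^ n%:R) `^ (u - 1)) * (C + 1) * K =
  (K `^ u * C `^ (u - 1) * (C + 1) * K) * (2 `^ n%:R) `^ (u - 1) by ring.
by rewrite ler_wpM2r ?powR_ge0// ler_wpDr// ler_norm.
Qed.
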